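(* Let $p$ be a natural number greater than $1$. There is a matrix $T$ with entries in the integral group ring $\mathbb Z[\mathbf Z_p\wr\mathbf Z]$ such that $$ \dim_{\mathrm{vN}}\ker T = 1344\left( \frac{4p^3+3p^2+2p-1}{8p^3} + \frac1{8p^3} \sum_{k=1}^\infty \left(\frac{p-1}{p}\right)^{k+2^{k}}\right), $$ and this number is transcendental.
   Context: $\mathbf Z_p$ is the cyclic group of order $p$, $\mathbf Z$ is the infinite cyclic group, and $\mathbf Z_p\wr\mathbf Z=\mathbf Z\ltimes\bigoplus_{\mathbb Z}\mathbf Z_p$ is the wreath product (lamplighter group), with $\mathbf Z$ acting by shifting coordinates. For a countable discrete group $G$, an $m\times n$ matrix $T$ over $\mathbb Z[G]$ acts as a bounded operator $l^2(G)^n\to l^2(G)^m$ by multiplication. The von Neumann dimension of its kernel is $\dim_{\mathrm{vN}}\ker T=\sum_{i=1}^n\langle P\zeta_i,\zeta_i\rangle$, where $P$ is the orthogonal projection of $l^2(G)^n$ onto $\ker T$ and $\zeta_i$ is the vector whose $i$-th entry is the indicator function of the neutral element of $G$ and whose other entries are $0$. *)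

(* Defs.v *)
From HB Require Import structures.
From mathcomp Require Export all_boot all_order all_algebra finmap.
From mathcomp.multinomials Require Export monalg.
From mathcomp Require Export all_classical all_reals all_analysis.
From mathcomp.real_closed Require Export complex.
From mathcomp.analysis.showcase Require summability.

Set Implicit Arguments.
Unset Strict Implicit.
Unset Printing Implicit Defensive.

Import Order.TTheory GRing.Theory Num.Theory numFieldNormedType.Exports.

Local Open Scope fset_scope.
Local Open Scope classical_set_scope.
Local Open Scope complex_scope.
Local Open Scope ring_scope.

(* {malg A[int]}, the finitely supported functions int -> A, is the direct    *)
(* sum of copies of A indexed by the integers.                                *)
Definition shift (A : zmodType) (n : int) (a : {malg A[int]}) : {malg A[int]} :=
  [malg i in [fset j + n | j in msupp a] => a@_(i - n)].

Lemma shiftE (A : zmodType) n (a : {malg A[int]}) i :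
  (shift n a)@_i = a@_(i - n).
Proof.
rewrite /shift mcoeffE; case: ifPn => // /negP iNa.
case: msuppP => // ia; case: iNa; apply/imfsetP.
by exists (i - n); rewrite //= subrK.
Qed.

(* The wreath product of A with Z; (n, a) stands for a t^n, where t is the    *)
(* generator of Z and t^n a t^-n = shift n a.                                 *)
Definition wreathZ (A : zmodType) : Type := (int * {malg A[int]})%type.

HB.instance Definition _ (A : zmodType) := Choice.on (wreathZ A).

Section WreathZGroup.
Variable A : zmodType.

Definition wone : wreathZ A := (0, 0).
Definition wmul (x y : wreathZ A) : wreathZ A :=
  (x.1 + y.1, x.2 + shift x.1 y.2).
Definition winv (x : wreathZ A) : wreathZ A := (- x.1, - shift (- x.1) x.2).

Lemma wmulA : associative wmul.
Proof.
move=> [n a] [m b] [k c]; rewrite /wmul /= addrA; congr pair.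
by apply/malgP => i; rewrite !(shiftE, mcoeffD, mcoeffN, mcoeff0) addrA opprD addrA.
Qed.

Lemma wmul1 : left_id wone wmul.
Proof.
move=> [n a]; rewrite /wmul /= add0r; congr pair.
by apply/malgP => i; rewrite !(shiftE, mcoeffD, mcoeffN, mcoeff0) subr0 add0r.
Qed.

Lemma wmulr1 : right_id wone wmul.
Proof.
move=> [n a]; rewrite /wmul /= addr0; congr pair.
by apply/malgP => i; rewrite !(shiftE, mcoeffD, mcoeffN, mcoeff0) addr0.
Qed.

Lemma wmulV : left_inverse wone winv wmul.
Proof.
move=> [n a]; rewrite /wmul /= addNr; congr pair.
by apply/malgP => i; rewrite !(shiftE, mcoeffD, mcoeffN, mcoeff0) addNr.
Qed.

Lemma wmulrV : right_inverse wone winv wmul.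
Proof.
move=> [n a]; rewrite /wmul /= addrN; congr pair.
by apply/malgP => i; rewrite !(shiftE, mcoeffD, mcoeffN, mcoeff0) opprK subrK addrN.
Qed.

HB.instance Definition _ :=
  isGroup.Build (wreathZ A) wmulA wmul1 wmulr1 wmulV wmulrV.

End WreathZGroup.

Section VonNeumannDimension.
Variables (R : realType) (G : groupType).

(* Families of functions G -> C indexed by 'I_n; those in l2 n below are the  *)
(* elements of l^2(G)^n.                                                      *)
Definition vec (n : nat) : Type := 'I_n -> G -> R[i].

Definition l2 (n : nat) : set (vec n) :=
  [set v | forall i, (\esum_(g in [set: G]) (ComplexField.Normc.normc (v i g) ^+ 2)%:E < +oo)%E].

(* summability.sum is the limit of the net of finite partial sums; it is      *)
(* meaningful here when u and v are in l2 n.                                  *)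
Definition inner (n : nat) (u v : vec n) : R[i] :=
  \sum_(i < n) summability.sum (fun g => u i g * (v i g)^* : R[i]^o).

(* {malg int[G]} is the integral group ring of G, acting by convolution on    *)
(* functions on G: (a f)(g) = \sum_h a_h f(h^-1 g).                           *)
Definition gract (a : {malg int[G]}) (f : G -> R[i]) : G -> R[i] :=
  fun g => \sum_(h <- msupp a) f (h^-1 * g)%g *~ a@_h.

Definition mxact (m n : nat) (T : 'M[{malg int[G]}]_(m, n)) (v : vec n) :
  vec m := fun i g => \sum_(j < n) gract (T i j) (v j) g.

Definition l2ker (m n : nat) (T : 'M[{malg int[G]}]_(m, n)) : set (vec n) :=
  [set v | l2 v /\ forall i g, mxact T v i g = 0].

(* The default value 0 is never taken when K is a closed subspace of l2 n and *)
(* x is in l2 n.                                                              *)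
Definition orth_proj (n : nat) (K : set (vec n)) (x : vec n) : vec n :=
  xget (fun _ _ => 0)
    [set y | K y /\
       forall z, K z -> inner (fun i g => x i g - y i g) z = 0].

Definition zeta (n : nat) (i : 'I_n) : vec n :=
  fun j g => ((j == i) && (g == 1%g))%:R.

Definition vN_dim_ker (m n : nat) (T : 'M[{malg int[G]}]_(m, n)) : R[i] :=
  \sum_(i < n) inner (orth_proj (l2ker T) (zeta i)) (zeta i).

End VonNeumannDimension.

(* Main.v *)
(** Averaging over the lamp at j is a projection; for j in Z these projections
    commute, so l^2 of the group splits along configurations in {0,1}^Z (0 for
    the range of the averaging at j, 1 for its complement) whose letters are
    independent with weights 1/p and x = (p-1)/p, and the generator of Z moves
    the origin of the configuration. A matrix whose rows test the letter at the
    origin and compare a vector with its translate is therefore a linear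
    recurrence that runs along the configuration. Take one with four components:
    along a run of a ones the first doubles, from v to 2^a v, and the second
    keeps v; at the next zero they are handed over to the last two, and along
    the following run of b ones the fourth loses v at each step and must end at
    0. A kernel vector lives on the words 0 1^a 0 1^b 0 with b = 2^a, one
    parameter on each, so the kernel has dimension sum_(a >= 0) p^-3 x^(a+2^a).
    Products of the projections themselves have dimensions p^-i x^j, and 168
    copies of a suitable direct sum give the required number.

    Transcendence is Mahler's method for F(z) = sum_k x^k z^(2^k), which
    satisfies F(z) = z + x F(z^2). If F(x) is algebraic, a polynomial P in z and
    F(z) vanishing to high order at 0 takes at z = x^(2^n) values that are too
    small for Liouville's inequality, hence vanish for all large n; but then the
    functional equation forces P = 0. *)

Require Import Defs.
From mathcomp Require Import ring lra zify perm.
Import Order.TTheory GRing.Theory Num.Theory numFieldNormedType.Exports.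
Import ComplexField.Normc.
Set Implicit Arguments.
Unset Strict Implicit.
Unset Printing Implicit Defensive.
Local Open Scope classical_set_scope.
Local Open Scope complex_scope.
Local Open Scope ring_scope.

(** * Unconditional sums and square-summable families *)

(* The splitting along infinite configurations is never formed: only finite words are applied, and
   the projection of each [zeta] onto the kernel is found as a limit. Explicit kernel vectors made
   from the words with a < L leave a remainder that is orthogonal to the kernel up to an error of
   order (M+1)^2 x^(M/2) with M = 2^L, the cost of neglecting runs of M or more ones. A run between
   two zeros is both the first run of one word and the second run of another, so the two pairs of
   components are matched with words by scanning in opposite directions.

   Liouville's inequality is obtained without number fields. An algebraic number is realized as an
   eigenvalue of a rational matrix M; a polynomial value G(beta) is then an eigenvalue of G(M), and
   the nonzero determinant of G(M) is bounded below by its denominator. The auxiliary polynomial has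
   fixed rational coefficients, so the denominators along z = x^(2^n) grow like powers of b^(2^n N),
   where x = a/b and N is the degree. The vanishing order N^2 beats them as soon as N is large
   compared with the degree of beta. *)
#[local] Existing Instance summability.totally_filter.

Section UnconditionalSums.
Variables (R : realType) (I : choiceType).
Implicit Types (f g : I -> R[i]) (s t : R[i]) (A B : {fset I}).

Definition hasum f s :=
  summability.partial_sum (f : I -> R[i]^o) @ summability.totally --> (s : R[i]^o).

Lemma psumE f A :
  summability.partial_sum (f : I -> R[i]^o) A = \sum_(i <- A) f i.
Proof. by rewrite /summability.partial_sum -(big_seq_fsetE _ _ xpredT f). Qed.

Lemma hasum_sum f s : hasum f s -> summability.sum (f : I -> R[i]^o) = s.
Proof.
move=> h; have hT : hausdorff_space R[i]^o by exact: norm_hausdorff.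
exact: cvg_lim h.
Qed.

Lemma hasumP f s : hasum f s <->
  forall e : R, 0 < e -> exists A, forall B, (A `<=` B)%fset ->
    normc (s - \sum_(i <- B) f i) < e.
Proof.
split=> [/cvgrPdist_lt h e e0|h].
  have e0' : (0 : R[i]) < e%:C by rewrite ltcR.
  have [A _ hA] := h _ e0'.
  exists A => B AB; have := hA B AB.
  by rewrite /= psumE -ltcR.
apply/(@cvgrPdist_lt _ R[i]^o) => e e0.
have eE : e = (complex.Re e)%:C.
  by case: e e0 => a b; rewrite ltcE /= => /andP[/eqP -> _].
move: e0; rewrite eE ltcR => /h[A hA]; exists A => // B AB /=.
by rewrite psumE ltcR; exact: hA.
Qed.

Lemma hasum_ext f g s : f =1 g -> hasum f s -> hasum g s.
Proof. by move=> /funext ->. Qed.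

Lemma hasumD f g s t : hasum f s -> hasum g t -> hasum (fun i => f i + g i) (s + t).
Proof.
move=> hf hg; rewrite /hasum.
have -> : summability.partial_sum ((fun i => f i + g i) : I -> R[i]^o) =
    (fun A => summability.partial_sum (f : I -> R[i]^o) A
            + summability.partial_sum (g : I -> R[i]^o) A).
  by apply/funext => A; rewrite !psumE big_split.
exact: (@cvgD R[i] R[i]^o _ _ _ (summability.partial_sum (f : I -> R[i]^o))
  (summability.partial_sum (g : I -> R[i]^o)) s t hf hg).
Qed.

Lemma hasumZ c f s : hasum f s -> hasum (fun i => c * f i) (c * s).
Proof.
move=> hf; rewrite /hasum.
have -> : summability.partial_sum ((fun i => c * f i) : I -> R[i]^o) =
    (fun A => c *: (summability.partial_sum (f : I -> R[i]^o) A : R[i]^o)).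
  by apply/funext => A; rewrite !psumE -mulr_sumr.
exact: (@cvgZl_tmp R[i] R[i]^o).
Qed.

Lemma hasum_conj f s : hasum f s -> hasum (fun i => (f i)^*) (s^*).
Proof.
move=> /hasumP h; apply/hasumP => e /h[A hA]; exists A => B /hA.
rewrite -rmorph_sum -rmorphB.
by case: (s - _) => a b /=; rewrite sqrrN.
Qed.

Lemma hasum_unique f s t : hasum f s -> hasum f t -> s = t.
Proof. by move=> /hasum_sum <- /hasum_sum <-. Qed.

Lemma hasum_fin A f : (forall i, i \notin A -> f i = 0) ->
  hasum f (\sum_(i <- A) f i).
Proof.
move=> fA; apply/hasumP => e e0; exists A => B AB.
rewrite -(big_fset_incl _ AB) ?subrr ?normc0 //= => i _; exact: fA.
Qed.

Lemma hasum_inj (phi psi : I -> I) f s : cancel phi psi -> cancel psi phi ->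
  hasum f s -> hasum (f \o phi) s.
Proof.
move=> phK psK /hasumP h; apply/hasumP => e /h[A hA].
exists [fset psi x | x in A]%fset => B AB.
have -> : \sum_(i <- B) (f \o phi) i = \sum_(i <- [fset phi x | x in B]%fset) f i.
  by rewrite big_imfset //= => x y _ _; exact: (can_inj phK).
apply: hA; apply/fsubsetP => x xA; apply/imfsetP; exists (psi x); rewrite ?psK //=.
by apply: (fsubsetP AB); apply/imfsetP; exists x.
Qed.

Lemma hasum_nneg (h : I -> R) (M : R) : (forall i, 0 <= h i) ->
  (forall A, \sum_(i <- A) h i <= M) ->
  exists s : R, [/\ hasum (fun i => (h i)%:C) s%:C,
    (forall A, \sum_(i <- A) h i <= s) & s <= M].
Proof.
move=> h0 hM; pose E := [set \sum_(i <- A) h i | A in [set: {fset I}]].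
have E0 : E !=set0 by exists (\sum_(i <- fset0) h i); exists fset0.
have ubE : has_ubound E by exists M => _ [A _ <-].
have le_sup A : \sum_(i <- A) h i <= sup E by apply: ub_le_sup => //; exists A.
exists (sup E); split => //; last by apply: ge_sup => // _ [A _ <-].
apply/hasumP => e e0.
have [_ [A _ <-] hA] := sup_adherent e0 (conj E0 ubE).
exists A => B AB; rewrite -rmorph_sum -rmorphB /= expr0n /= addr0 sqrtr_sqr.
rewrite ger0_norm ?subr_ge0 // ltrBlDr -ltrBlDl.
apply: (lt_le_trans hA); rewrite (big_fsetID _ (mem A) B) /=.
have -> : [fset x | x in B & x \in A]%fset = A.
  apply/fsetP => x; rewrite !inE /=; apply/andP/idP => [[]//|xA].
  by split=> //; exact: (fsubsetP AB).
by rewrite lerDl sumr_ge0.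
Qed.

End UnconditionalSums.
Arguments hasumZ [R I] c [f s].

Section SquareSummable.
Variables (R : realType) (I : choiceType).
Implicit Types (f g h : I -> R[i]) (A B : {fset I}).

Definition sqsum f :=
  exists M : R, forall A, \sum_(i <- A) normc (f i) ^+ 2 <= M.

Lemma normc_ge0 (x : R[i]) : 0 <= normc x.
Proof. by case: x => a b; exact: sqrtr_ge0. Qed.

Lemma sqr_normcE (x : R[i]) : (normc x ^+ 2)%:C = x * x^*.
Proof. by rewrite -sqr_normc rmorphXn. Qed.

Lemma normc_conj (x : R[i]) : normc x^* = normc x.
Proof. by case: x => a b /=; rewrite sqrrN. Qed.

Lemma sqsumD f g : sqsum f -> sqsum g -> sqsum (fun i => f i + g i).
Proof.
move=> [M hM] [N hN]; exists (2 * M + 2 * N) => A.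
apply: (@le_trans _ _ (\sum_(i <- A) (2 * normc (f i) ^+ 2 + 2 * normc (g i) ^+ 2))).
  apply: ler_sum => i _.
  have := le_normcD (f i) (g i).
  have := normc_ge0 (f i + g i); have := normc_ge0 (f i); have := normc_ge0 (g i).
  move: (normc (f i + g i)) (normc (f i)) (normc (g i)) => c a b b0 a0 c0 cab.
  have : c ^+ 2 <= (a + b) ^+ 2 by rewrite ler_sqr ?nnegrE ?addr_ge0 ?cab.
  rewrite sqrrD => h.
  by have := sqr_ge0 (a - b); rewrite sqrrB; lra.
by rewrite big_split /= -!mulr_sumr lerD // ler_pM2l.
Qed.

Lemma sqsumZ c f : sqsum f -> sqsum (fun i => c * f i).
Proof.
move=> [M hM]; exists (normc c ^+ 2 * M) => A.
under eq_bigr do rewrite normcM exprMn.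
by rewrite -mulr_sumr ler_wpM2l // sqr_ge0.
Qed.

Lemma sqsum0 : sqsum (fun=> 0).
Proof. by exists 0 => A; rewrite big1 // => i _; rewrite normc0 expr0n. Qed.

Lemma sqsumB f g : sqsum f -> sqsum g -> sqsum (fun i => f i - g i).
Proof.
move=> hf hg; have := sqsumD hf (sqsumZ (-1) hg).
by under eq_fun do rewrite mulN1r.
Qed.

Lemma sqsum_sum (J : Type) (r : seq J) (P : pred J) (F : J -> I -> R[i]) :
  (forall j, P j -> sqsum (F j)) -> sqsum (fun i => \sum_(j <- r | P j) F j i).
Proof.
move=> hF; elim: r => [|j r IH].
  by rewrite (_ : (fun _ => _) = fun=> 0); [exact: sqsum0|apply/funext => i; rewrite big_nil].
case Pj : (P j); last by rewrite (_ : (fun _ => _) = (fun i => \sum_(j <- r | P j) F j i));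
  [|apply/funext => i; rewrite big_cons Pj].
rewrite (_ : (fun _ => _) = (fun i => F j i + \sum_(j <- r | P j) F j i)).
  by apply: sqsumD => //; exact: hF.
by apply/funext => i; rewrite big_cons Pj.
Qed.

Lemma sqsum_inj (phi psi : I -> I) f : cancel phi psi -> sqsum f -> sqsum (f \o phi).
Proof.
move=> phK [M hM]; exists M => A.
have -> : \sum_(i <- A) normc ((f \o phi) i) ^+ 2 =
   \sum_(i <- [fset phi x | x in A]%fset) normc (f i) ^+ 2.
  by rewrite big_imfset //= => x y _ _; exact: (can_inj phK).
exact: hM.
Qed.

Lemma sqsum_fin A f : (forall i, i \notin A -> f i = 0) -> sqsum f.
Proof.
move=> fA; exists (\sum_(i <- A) normc (f i) ^+ 2) => B.
rewrite (big_fsetID _ (mem A) B) /= addrC big_seq big1 ?add0r; last first.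
  by move=> i; rewrite !inE /= => /andP[_ /fA ->]; rewrite normc0 expr0n.
rewrite [leRHS](big_fsetID _ (mem B) A) /=.
have -> : [fset x in B | x \in A]%fset = [fset x in A | x \in B]%fset.
  by apply/fsetP => x; rewrite !inE /= andbC.
by rewrite lerDl sumr_ge0 // => i _; exact: sqr_ge0.
Qed.

Lemma hasum_sq f : sqsum f -> exists s : R, [/\ hasum (fun i => f i * (f i)^*) s%:C,
  (forall A, \sum_(i <- A) normc (f i) ^+ 2 <= s) &
  (forall M, (forall A, \sum_(i <- A) normc (f i) ^+ 2 <= M) -> s <= M)].
Proof.
move=> [M hM].
have [|s [hs sA _]] := hasum_nneg _ hM; first by move=> i; exact: sqr_ge0.
have hE (x : R) : hasum (fun i => (normc (f i) ^+ 2)%:C) x%:C ->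
   hasum (fun i => f i * (f i)^*) x%:C.
  by apply: hasum_ext => i; rewrite sqr_normcE.
exists s; split => //; first exact: hE.
move=> N hN; have [|t [ht tA tN]] := hasum_nneg _ hN.
  by move=> i; exact: sqr_ge0.
by have /complexI -> := hasum_unique hs ht.
Qed.

(** Polarization: f times the conjugate of g is a combination of the families |f + c g|^2 for c = 1,
    -1, i, -i, and these are summable because their terms are nonnegative and their finite sums
    bounded. *)
Lemma hasum_mulconj f g : sqsum f -> sqsum g ->
  exists s, hasum (fun i => f i * (g i)^*) s.
Proof.
move=> hf hg.
have hs (c : R[i]) : exists s, hasum (fun i => (f i + c * g i) * (f i + c * g i)^*) s.
  have [s [h _ _]] := hasum_sq (sqsumD hf (sqsumZ c hg)).
  by exists s%:C.
have [s0 h0] := hs 1; have [s1 h1] := hs (-1).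
have [s2 h2] := hs 'i%R; have [s3 h3] := hs (- 'i%R).
exists (4^-1 * (s0 + ((-1) * s1 + ('i%R * s2 + (- 'i%R) * s3)))).
have h := hasumZ 4^-1 (hasumD h0 (hasumD (hasumZ (-1) h1)
   (hasumD (hasumZ 'i%R h2) (hasumZ (- 'i%R) h3)))).
apply: hasum_ext h => i.
rewrite !rmorphD !rmorphM !rmorphN !rmorph1 /= conjCi.
have := sqrCi R[i].
move: (f i) (g i) (f i)^* (g i)^* => a b a' b' ii.
have n4 : (4 : R[i]) != 0 by rewrite pnatr_eq0.
apply: (mulfI n4); rewrite mulVKf //.
move: ('i%R : R[i]) ii => j jj.
have -> : (a + 1 * b) * (a' + 1 * b') +
 (-1 * ((a + -1 * b) * (a' + -1 * b')) +
  (j * ((a + j * b) * (a' + - j * b')) +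
   - j * ((a + - j * b) * (a' + - - j * b')))) =
   2 * (a * b' + b * a') + 2 * j ^+ 2 * (b * a' - a * b') by ring.
by rewrite jj; ring.
Qed.

Definition ip f g : R[i] := summability.sum (fun i => f i * (g i)^* : R[i]^o).

Lemma ipP f g : sqsum f -> sqsum g -> hasum (fun i => f i * (g i)^*) (ip f g).
Proof. by move=> hf /(hasum_mulconj hf)[s hs]; rewrite /ip (hasum_sum hs). Qed.

Lemma ip_unique f g s : hasum (fun i => f i * (g i)^*) s -> ip f g = s.
Proof. exact: hasum_sum. Qed.

Lemma ipDl f g h : sqsum f -> sqsum g -> sqsum h ->
  ip (fun i => f i + g i) h = ip f h + ip g h.
Proof.
move=> hf hg hh; apply: ip_unique.
by apply: hasum_ext (hasumD (ipP hf hh) (ipP hg hh)) => i; rewrite mulrDl.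
Qed.

Lemma ipZl c f g : sqsum f -> sqsum g -> ip (fun i => c * f i) g = c * ip f g.
Proof.
move=> hf hg; apply: ip_unique.
by apply: hasum_ext (hasumZ c (ipP hf hg)) => i; rewrite mulrA.
Qed.

Lemma ipC f g : sqsum f -> sqsum g -> ip g f = (ip f g)^*.
Proof.
move=> hf hg; apply: ip_unique.
by apply: hasum_ext (hasum_conj (ipP hf hg)) => i; rewrite rmorphM /= conjCK mulrC.
Qed.

Lemma ipDr f g h : sqsum f -> sqsum g -> sqsum h ->
  ip h (fun i => f i + g i) = ip h f + ip h g.
Proof.
move=> hf hg hh; rewrite (ipC _ hh) ?ipDl //; last exact: sqsumD.
by rewrite rmorphD /= -!ipC.
Qed.

Lemma ipZr c f g : sqsum f -> sqsum g -> ip g (fun i => c * f i) = c^* * ip g f.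
Proof.
move=> hf hg; rewrite (ipC _ hg) ?ipZl //; last exact: sqsumZ.
by rewrite rmorphM /= -ipC.
Qed.

Lemma ip0l g : ip (fun=> 0) g = 0.
Proof.
apply: ip_unique; have := @hasum_fin R I fset0 (fun i => 0 * (g i)^*).
by rewrite big_nil; apply => i _; rewrite mul0r.
Qed.

Lemma ip_suml (J : Type) (r : seq J) (P : pred J) (F : J -> I -> R[i]) g :
  (forall j, P j -> sqsum (F j)) -> sqsum g ->
  ip (fun i => \sum_(j <- r | P j) F j i) g = \sum_(j <- r | P j) ip (F j) g.
Proof.
move=> hF hg; elim: r => [|j r IH].
  by rewrite big_nil -[RHS](ip0l g); congr ip; apply/funext => i; rewrite big_nil.
rewrite big_cons; case Pj : (P j); last first.
  by rewrite -IH; congr ip; apply/funext => i; rewrite big_cons Pj.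
rewrite -IH -ipDl //; [|exact: hF|exact: sqsum_sum].
by congr ip; apply/funext => i; rewrite big_cons Pj.
Qed.

Definition nsq f : R := complex.Re (ip f f).

Lemma ipff f : sqsum f -> ip f f = (nsq f)%:C.
Proof. by move=> /hasum_sq[s [hs _ _]]; rewrite /nsq (ip_unique hs). Qed.

Lemma sum_le_nsq f A : sqsum f -> \sum_(i <- A) normc (f i) ^+ 2 <= nsq f.
Proof. by move=> /hasum_sq[s [hs hA _]]; rewrite /nsq (ip_unique hs). Qed.

Lemma nsq_le f M : (forall A, \sum_(i <- A) normc (f i) ^+ 2 <= M) -> nsq f <= M.
Proof.
move=> hM; have [|s [hs _ h]] := @hasum_sq f; first by exists M.
by rewrite /nsq (ip_unique hs) /=; exact: h.
Qed.

Lemma nsq_ge0 f : sqsum f -> 0 <= nsq f.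
Proof. by move=> /(sum_le_nsq fset0); rewrite big_nil. Qed.

Lemma normc_le_nsq f i : sqsum f -> normc (f i) ^+ 2 <= nsq f.
Proof. by move=> /(sum_le_nsq [fset i]%fset); rewrite big_seq_fset1. Qed.

End SquareSummable.

(** The Cauchy-Schwarz inequality in the abstract: [a], [b], [s] stand for |u|^2, |v|^2, <u, v>, and
    the hypothesis for |u - c v|^2 >= 0, tested at c = t s with t real. In this form it serves
    single functions and tuples alike. *)
Lemma discriminant (R : realType) (a b : R) (s : R[i]) :
  0 <= b ->
  (forall c : R[i], 0 <= a%:C - c^* * s - c * s^* + c * c^* * b%:C) ->
  normc s ^+ 2 <= a * b.
Proof.
move=> b0 h.
have hr (t : R) : 0 <= a - 2 * t * normc s ^+ 2 + t ^+ 2 * normc s ^+ 2 * b.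
  have := h (t%:C * s).
  have -> : (t%:C * s)^* = t%:C * s^* by rewrite rmorphM /=; congr (_ * _); exact: conjc_real.
  rewrite -ler0c; congr (_ <= _).
  move: (normc s ^+ 2 : R) (sqr_normcE s) => n nE.
  by rewrite !(rmorphD, rmorphN, rmorphM, rmorphXn, rmorph_nat) /= nE; ring.
have := sqr_ge0 (normc s); move: (normc s ^+ 2) hr => n hr n0.
have [b00|bn0] := eqVneq b 0; last first.
  have := hr b^-1; have -> : a - 2 * b^-1 * n + b^-1 ^+ 2 * n * b = a - n / b.
    by field.
  by rewrite subr_ge0 ler_pdivrMr // lt_neqAle eq_sym bn0.
rewrite b00 mulr0; apply/negP => /negP; rewrite -ltNge => np.
(* For b = 0 the form is affine in t, and this t gives it the value -1. *)
have := hr ((a + 1) / (2 * n)); rewrite b00 mulr0 addr0.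
have -> : a - 2 * ((a + 1) / (2 * n)) * n = -1 by field; exact: lt0r_neq0.
by rewrite ler0N1.
Qed.

Lemma ip_expand (R : realType) (I : choiceType) (f g : I -> R[i]) (c : R[i]) :
  sqsum f -> sqsum g ->
  (nsq (fun i => f i - c * g i))%:C =
  (nsq f)%:C - c^* * ip f g - c * (ip f g)^* + c * c^* * (nsq g)%:C.
Proof.
move=> hf hg; rewrite -ipff; last by apply: sqsumB => //; exact: sqsumZ.
have hcg := sqsumZ (- c) hg.
have -> : (fun i => f i - c * g i) = (fun i => f i + (- c) * g i).
  by apply/funext => i; rewrite mulNr.
have hs := sqsumD hf hcg.
rewrite ipDl ?ipDr ?ipZl ?ipZr // -ipC // !ipff // rmorphN /=.
by ring.
Qed.

Section Vectors.
Variables (R : realType) (G : groupType).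

Lemma l2P n (v : vec R G n) : l2 v <-> forall i, sqsum (v i).
Proof.
split=> h i.
  have h0 g : (0 <= (normc (v i g) ^+ 2)%:E)%E by rewrite lee_fin sqr_ge0.
  move: (h i); have := @esum_ge0 R G [set: G] _ (fun g _ => h0 g).
  case E : esum => [M| |] // _ _; exists M => A.
  rewrite -lee_fin -E -sumEFin; apply: ereal_sup_ubound; exists [set` A] => //.
  by rewrite fsbig_finite //= set_fsetK.
have [M hM] := h i.
apply: (@le_lt_trans _ _ M%:E); last exact: ltry.
apply: ge_ereal_sup => _ [A [fA _] <-].
rewrite fsbig_finite //= sumEFin lee_fin; exact: hM.
Qed.

Definition nsqv n (v : vec R G n) : R := \sum_i nsq (v i).

Lemma innerE n (u v : vec R G n) : inner u v = \sum_i ip (u i) (v i).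
Proof. by []. Qed.

Lemma inner_self n (v : vec R G n) : l2 v -> inner v v = (nsqv v)%:C.
Proof.
by move=> /l2P h; rewrite innerE rmorph_sum; apply: eq_bigr => i _; exact: ipff.
Qed.

Lemma nsqv_ge0 n (v : vec R G n) : l2 v -> 0 <= nsqv v.
Proof. by move=> /l2P h; apply: sumr_ge0 => i _; exact: nsq_ge0. Qed.

Lemma nsq_le_nsqv n (v : vec R G n) i : l2 v -> nsq (v i) <= nsqv v.
Proof.
move=> /l2P h; rewrite /nsqv (bigD1 i) //= lerDl sumr_ge0 // => j _.
exact: nsq_ge0.
Qed.

Definition vadd n (u v : vec R G n) : vec R G n := fun i g => u i g + v i g.
Definition vsub n (u v : vec R G n) : vec R G n := fun i g => u i g - v i g.

Lemma l2B n (u v : vec R G n) : l2 u -> l2 v -> l2 (vsub u v).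
Proof. by move=> /l2P hu /l2P hv; apply/l2P => i; exact: sqsumB. Qed.

Lemma innerDl n (u v w : vec R G n) : l2 u -> l2 v -> l2 w ->
  inner (vadd u v) w = inner u w + inner v w.
Proof.
move=> /l2P hu /l2P hv /l2P hw; rewrite !innerE -big_split.
by apply: eq_bigr => i _; exact: ipDl.
Qed.

Lemma innerBl n (u v w : vec R G n) : l2 u -> l2 v -> l2 w ->
  inner (vsub u v) w = inner u w - inner v w.
Proof.
move=> hu hv hw; apply: (addIr (inner v w)).
rewrite subrK -innerDl //; last exact: l2B.
by congr inner; apply/funext => i; apply/funext => g; rewrite /vadd /vsub subrK.
Qed.

Lemma cauchy_schwarz_inner n (u v : vec R G n) : l2 u -> l2 v ->
  normc (inner u v) ^+ 2 <= nsqv u * nsqv v.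
Proof.
move=> hu hv; apply: discriminant => [|c]; first exact: nsqv_ge0.
move/l2P: hu => hu; move/l2P: hv => hv.
have -> : (nsqv u)%:C - c^* * inner u v - c * (inner u v)^* + c * c^* * (nsqv v)%:C
   = (\sum_i nsq (fun g => u i g - c * v i g))%:C.
  rewrite [RHS]rmorph_sum [RHS](eq_bigr _ (fun i _ => ip_expand c (hu i) (hv i))).
  rewrite !big_split /= innerE rmorph_sum /= !mulr_sumr -!sumrN /nsqv !rmorph_sum /=.
  by rewrite !sumrN !mulr_sumr.
rewrite ler0c sumr_ge0 // => i _; apply: nsq_ge0; apply: sqsumB => //.
exact: sqsumZ.
Qed.

End Vectors.

Lemma cauchy_schwarz (R : realType) (I : choiceType) (f g : I -> R[i]) :
  sqsum f -> sqsum g -> normc (ip f g) ^+ 2 <= nsq f * nsq g.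
Proof.
move=> hf hg; apply: discriminant => [|c]; first exact: nsq_ge0.
rewrite -ip_expand // ler0c; apply: nsq_ge0; apply: sqsumB => //.
exact: sqsumZ.
Qed.

(** * Orthogonal projections as limits *)

Section ComplexLimits.
Variable R : realType.

Lemma sqr_normcD (z : R[i]) :
  normc z ^+ 2 = complex.Re z ^+ 2 + complex.Im z ^+ 2.
Proof. by case: z => a b /=; rewrite sqr_sqrtr // addr_ge0 ?sqr_ge0. Qed.

Lemma ReD (x y : R[i]) : complex.Re (x + y) = complex.Re x + complex.Re y.
Proof. by case: x y => [? ?] []. Qed.

Lemma ImD (x y : R[i]) : complex.Im (x + y) = complex.Im x + complex.Im y.
Proof. by case: x y => [? ?] []. Qed.

Lemma ReM (x y : R[i]) :
  complex.Re (x * y) = complex.Re x * complex.Re y - complex.Im x * complex.Im y.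
Proof. by case: x y => [? ?] []. Qed.

Lemma ImM (x y : R[i]) :
  complex.Im (x * y) = complex.Re x * complex.Im y + complex.Im x * complex.Re y.
Proof. by case: x y => [? ?] []. Qed.

Definition ccvg (u : nat -> R[i]) (l : R[i]) :=
  (complex.Re (u n) @[n --> \oo] --> complex.Re l) /\
  (complex.Im (u n) @[n --> \oo] --> complex.Im l).

Lemma ccvgD u v l k : ccvg u l -> ccvg v k -> ccvg (fun n => u n + v n) (l + k).
Proof.
move=> [u1 u2] [v1 v2]; split; rewrite (ReD, ImD).
  by under eq_fun do rewrite ReD; exact: cvgD.
by under eq_fun do rewrite ImD; exact: cvgD.
Qed.

Lemma ccvg_cst l : ccvg (fun=> l) l.
Proof. by split; exact: cvg_cst. Qed.

Lemma ccvgM c u l : ccvg u l -> ccvg (fun n => c * u n) (c * l).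
Proof.
move=> [u1 u2]; split; rewrite (ReM, ImM).
  by under eq_fun do rewrite ReM; apply: cvgB; apply: cvgM => //; exact: cvg_cst.
by under eq_fun do rewrite ImM; apply: cvgD; apply: cvgM => //; exact: cvg_cst.
Qed.

Lemma ccvg_sum (J : Type) (r : seq J) (u : J -> nat -> R[i]) (l : J -> R[i]) :
  (forall j, ccvg (u j) (l j)) ->
  ccvg (fun n => \sum_(j <- r) u j n) (\sum_(j <- r) l j).
Proof.
move=> h; elim: r => [|j r IH].
  rewrite big_nil (_ : (fun n => _) = fun=> 0); first exact: ccvg_cst.
  by apply/funext => n; rewrite big_nil.
rewrite big_cons (_ : (fun n => _) = fun n => u j n + \sum_(j <- r) u j n).
  exact: ccvgD.
by apply/funext => n; rewrite big_cons.
Qed.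

Lemma ccvg_unique u l k : ccvg u l -> ccvg u k -> l = k.
Proof.
case: l k => [l1 l2] [k1 k2] [/= a1 a2] [/= b1 b2].
congr Complex.
  exact: (@cvg_unique _ (@norm_hausdorff _ R) _ _ _ _ a1 b1).
exact: (@cvg_unique _ (@norm_hausdorff _ R) _ _ _ _ a2 b2).
Qed.

Lemma ccvg_sqr_normc u l : ccvg u l ->
  normc (u n) ^+ 2 @[n --> \oo] --> normc l ^+ 2.
Proof.
move=> [u1 u2]; rewrite sqr_normcD; under eq_fun do rewrite sqr_normcD.
by apply: cvgD; rewrite expr2; under eq_fun do rewrite expr2; exact: cvgM.
Qed.

Lemma cvg_of_dist (a eps : nat -> R) : eps @ \oo --> 0 ->
  (forall m n, `|a m - a n| <= eps m + eps n) -> cvgn a.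
Proof.
move=> e0 h; apply/cauchy_cvgP.
apply/cauchyP => e e_gt0.
have e2 : 0 < e / 2 by rewrite divr_gt0.
have [N _ hN] := (cvgrPdist_lt _ _).1 e0 _ e2.
exists (a N); exists N => // m Nm /=; rewrite /ball /=.
apply: (le_lt_trans (h _ _)).
have := hN _ (leqnn N); have := hN _ Nm; rewrite /= !sub0r !normrN => h1 h2.
rewrite [e]splitr; apply: ltrD.
  exact: le_lt_trans (ler_norm _) h2.
exact: le_lt_trans (ler_norm _) h1.
Qed.

Lemma ccvg_of_dist (u : nat -> R[i]) (eps : nat -> R) : eps @ \oo --> 0 ->
  (forall n, 0 <= eps n) ->
  (forall m n, normc (u m - u n) ^+ 2 <= (eps m + eps n) ^+ 2) ->
  exists l, ccvg u l.
Proof.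
move=> e0 e_ge0 h.
have c1 : cvgn (fun n => complex.Re (u n)).
  apply: (cvg_of_dist e0) => m n.
  rewrite -ler_sqr ?nnegrE ?addr_ge0 // real_normK ?num_real //.
  apply: le_trans (h m n); rewrite sqr_normcD.
  by case: (u m) (u n) => [? ?] [? ?] /=; rewrite lerDl sqr_ge0.
have c2 : cvgn (fun n => complex.Im (u n)).
  apply: (cvg_of_dist e0) => m n.
  rewrite -ler_sqr ?nnegrE ?addr_ge0 // real_normK ?num_real //.
  apply: le_trans (h m n); rewrite sqr_normcD.
  by case: (u m) (u n) => [? ?] [? ?] /=; rewrite lerDr sqr_ge0.
by exists (lim (complex.Re (u n) @[n --> \oo]) +i* lim (complex.Im (u n) @[n --> \oo])).
Qed.

End ComplexLimits.

Section OrthogonalProjection.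
Variables (R : realType) (G : groupType).

Lemma vsub_l2ker m n (T : 'M[{malg int[G]}]_(m, n)) (u v : vec R G n) :
  l2ker T u -> l2ker T v -> l2ker T (vsub u v).
Proof.
move=> [u2 u0] [v2 v0]; split=> [|i g]; first exact: l2B.
have -> : mxact T (vsub u v) i g = mxact T u i g - mxact T v i g.
  rewrite /mxact -sumrB; apply: eq_bigr => j _; rewrite /gract -sumrB.
  by apply: eq_bigr => h _; rewrite mulrzBl.
by rewrite u0 v0 subrr.
Qed.

Lemma normc_le_sqrt (z : R[i]) (a : R) : normc z ^+ 2 <= a -> normc z <= Num.sqrt a.
Proof.
move=> h; have a0 : 0 <= a by apply: le_trans h; exact: sqr_ge0.
by rewrite -ler_sqr ?nnegrE ?sqrtr_ge0 ?normc_ge0 // sqr_sqrtr.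
Qed.

(** Testing the almost orthogonality of x - y_M and x - y_N against y_M - y_N, itself a kernel
    vector, gives |y_M - y_N| <= eps M + eps N, so the sequence converges entry by entry. Each
    kernel equation involves finitely many entries and passes to the limit. *)
Lemma orth_proj_exists m n (T : 'M[{malg int[G]}]_(m, n)) (x : vec R G n)
    (y_ : nat -> vec R G n) (eps : nat -> R) :
  l2 x -> (forall N, l2ker T (y_ N)) -> eps @ \oo --> 0 -> (forall N, 0 <= eps N) ->
  (forall N z, l2ker T z ->
     normc (inner (vsub x (y_ N)) z) ^+ 2 <= eps N ^+ 2 * nsqv z) ->
  exists y, [/\ l2ker T y, forall z, l2ker T z -> inner (vsub x y) z = 0 &
    forall i g, ccvg (fun N => y_ N i g) (y i g)].
Proof.
move=> x2 yK eps0 eps_ge0 hy.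
have y2 N : l2 (y_ N) by case: (yK N).
have dist M N : nsqv (vsub (y_ M) (y_ N)) <= (eps M + eps N) ^+ 2.
  set w := vsub _ _; have wK : l2ker T w by exact: vsub_l2ker.
  have w2 : l2 w by case: wK.
  have e : (nsqv w)%:C = inner (vsub x (y_ N)) w - inner (vsub x (y_ M)) w.
    rewrite -inner_self // -innerBl //; try exact: l2B.
    by congr inner; apply/funext => i; apply/funext => g; rewrite /w /vsub; ring.
  have hN : normc (inner (vsub x (y_ N)) w) <= eps N * Num.sqrt (nsqv w).
    have -> : eps N = Num.sqrt (eps N ^+ 2) by rewrite sqrtr_sqr ger0_norm.
    by rewrite -sqrtrM ?sqr_ge0 //; apply: normc_le_sqrt; exact: hy.
  have hM : normc (inner (vsub x (y_ M)) w) <= eps M * Num.sqrt (nsqv w).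
    have -> : eps M = Num.sqrt (eps M ^+ 2) by rewrite sqrtr_sqr ger0_norm.
    by rewrite -sqrtrM ?sqr_ge0 //; apply: normc_le_sqrt; exact: hy.
  have := le_normcD (inner (vsub x (y_ N)) w) (- inner (vsub x (y_ M)) w).
  rewrite -e normcN; have s0 := nsqv_ge0 w2.
  have -> : normc (nsqv w)%:C = Num.sqrt (nsqv w) ^+ 2.
    by rewrite sqr_sqrtr //= expr0n /= addr0 sqrtr_sqr ger0_norm.
  rewrite -[X in _ -> X <= _](sqr_sqrtr s0).
  have := sqrtr_ge0 (nsqv w); move: (Num.sqrt _) hN hM => t hN hM t0 ht.
  rewrite ler_sqr ?nnegrE ?addr_ge0 //.
  have [->|tn0] := eqVneq t 0; first by rewrite addr_ge0.
  have tp : 0 < t by rewrite lt_neqAle eq_sym tn0.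
  rewrite -(ler_pM2r tp) mulrDl -expr2; apply: (le_trans ht).
  by rewrite addrC lerD.
have hp i g : exists l, ccvg (fun N => y_ N i g) l.
  apply: (ccvg_of_dist eps0 eps_ge0) => M N.
  have w2 := l2B (y2 M) (y2 N).
  apply: le_trans (dist M N); apply: le_trans (nsq_le_nsqv i w2).
  exact: (@normc_le_nsq _ _ (vsub (y_ M) (y_ N) i) g ((l2P _).1 w2 i)).
pose y : vec R G n := fun i g => projT1 (cid (hp i g)).
have hyc i g : ccvg (fun N => y_ N i g) (y i g) by rewrite /y; case: cid.
(* The bound passes to the limit on a finite set of entries; as it does not depend on the set, it
   holds for the whole component. *)
have hB N i (A : {fset G}) : \sum_(g <- A) normc (y_ N i g - y i g) ^+ 2 <= eps N ^+ 2.
  have c1 : \sum_(g <- A) normc (y_ N i g - y_ M i g) ^+ 2 @[M --> \oo]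
     --> \sum_(g <- A) normc (y_ N i g - y i g) ^+ 2.
    apply: cvg_big => [|g _]; first exact: add_continuous.
    apply: ccvg_sqr_normc; apply: ccvgD; first exact: ccvg_cst.
    have := ccvgM (-1) (hyc i g); rewrite mulN1r.
    by under eq_fun do rewrite mulN1r.
  have c2 : (eps N + eps M) ^+ 2 @[M --> \oo] --> eps N ^+ 2.
    have -> : eps N ^+ 2 = (eps N + 0) * (eps N + 0) by rewrite addr0 expr2.
    under eq_fun do rewrite expr2.
    by apply: cvgM; apply: cvgD => //; exact: cvg_cst.
  apply: (ler_cvg_to c1 c2).
  near=> M; apply: le_trans (dist N M).
  have w2 := l2B (y2 N) (y2 M).
  apply: le_trans (nsq_le_nsqv i w2).
  exact: (@sum_le_nsq _ _ (vsub (y_ N) (y_ M) i) A ((l2P _).1 w2 i)).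
have d2 N : l2 (vsub (y_ N) y).
  by apply/l2P => i; exists (eps N ^+ 2) => A; exact: hB.
have yl2 : l2 y.
  rewrite (_ : y = vsub (y_ 0%N) (vsub (y_ 0%N) y)); first exact: l2B.
  by apply/funext => i; apply/funext => g; rewrite /vsub; ring.
have yker : l2ker T y.
  split=> // i g; apply: (@ccvg_unique _ (fun N => mxact T (y_ N) i g)).
    apply: ccvg_sum => j; rewrite /gract; apply: ccvg_sum => h.
    rewrite -mulrzr mulrC; under eq_fun do rewrite -mulrzr mulrC.
    exact: ccvgM.
  under eq_fun do rewrite (yK _).2; exact: ccvg_cst.
exists y; split => // z [z2 z0].
apply: eq0_normc; apply/eqP; rewrite eq_le normc_ge0 andbT.
(* The square root of [n] appears because each of the [n] components of y_N - y has norm at most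
   [eps N]. *)
pose c : R := (1 + Num.sqrt n%:R) * Num.sqrt (nsqv z).
have hc : c * eps N @[N --> \oo] --> 0.
  have := cvgM (cvg_cst c) eps0; rewrite mulr0; exact.
apply: (ler_cvg_to (cvg_cst _) hc).
near=> N.
have -> : inner (vsub x y) z = inner (vsub x (y_ N)) z + inner (vsub (y_ N) y) z.
  rewrite -innerDl //; try exact: l2B.
  by congr inner; apply/funext => i; apply/funext => g; rewrite /vsub /vadd; ring.
apply: (le_trans (le_normcD _ _)); rewrite /c mulrAC mulrDl mul1r mulrDl lerD //.
  have -> : eps N = Num.sqrt (eps N ^+ 2) by rewrite sqrtr_sqr ger0_norm.
  by rewrite -sqrtrM ?sqr_ge0 //; apply: normc_le_sqrt; exact: hy.
have -> : eps N = Num.sqrt (eps N ^+ 2) by rewrite sqrtr_sqr ger0_norm.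
rewrite -!sqrtrM ?mulr_ge0 ?sqr_ge0 //; apply: normc_le_sqrt.
apply: (le_trans (cauchy_schwarz_inner (d2 N) z2)).
apply: ler_wpM2r; first exact: nsqv_ge0.
rewrite /nsqv mulr_natl -[in leRHS](card_ord n) -sumr_const; apply: ler_sum => i _.
by apply: nsq_le => A; exact: hB.
Unshelve. all: by end_near. Qed.

(** Two candidates differ by a kernel vector that is orthogonal to itself, so the choice made by
    [xget] is forced. *)
Lemma orth_projE m n (T : 'M[{malg int[G]}]_(m, n)) (x y : vec R G n) :
  l2 x -> l2ker T y -> (forall z, l2ker T z -> inner (vsub x y) z = 0) ->
  orth_proj (l2ker T) x = y.
Proof.
move=> x2 yK hy; rewrite /orth_proj; case: xgetP => [y' _ [y'K hy']|/(_ y)]; last first.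
  by move=> h; exfalso; apply: h; split.
have [[y2 _] [y'2 _]] := (yK, y'K).
have wK := vsub_l2ker yK y'K; set w := vsub y y' in wK.
have w2 : l2 w by case: wK.
have w0 : (nsqv w)%:C = 0.
  rewrite -inner_self //.
  have -> : inner w w = inner (vsub x y') w - inner (vsub x y) w.
    rewrite -innerBl //; try exact: l2B.
    by congr inner; apply/funext => i; apply/funext => g; rewrite /w /vsub; ring.
  by rewrite hy // [inner _ _]hy' // subr0.
apply/funext => i; apply/funext => g; apply/eqP; rewrite eq_sym -subr_eq0; apply/eqP.
apply: eq0_normc; apply/eqP; rewrite -sqrf_eq0 eq_le sqr_ge0 andbT.
move/complexI: w0 => <-; apply: le_trans (nsq_le_nsqv i w2).
exact: (@normc_le_nsq _ _ (w i) g ((l2P _).1 w2 i)).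
Qed.

End OrthogonalProjection.

(** * Kernel dimensions and direct sums *)

Section KernelDimension.
Variables (R : realType) (G : groupType).

(** The projections of the vectors [zeta] are given as witnesses through their characterization, and
    the pairing with [zeta i] is replaced by an entry at the identity; direct sums can then be
    formed without touching [orth_proj]. *)
Definition kerdim m n (T : 'M[{malg int[G]}]_(m, n)) (d : R) :=
  exists y : 'I_n -> vec R G n,
    (forall i, @l2ker R G m n T (y i) /\
       forall z, l2ker T z -> inner (vsub (zeta R i) (y i)) z = 0) /\
    \sum_i y i i 1%g = d%:C.

Lemma l2_zeta n (i : 'I_n) : l2 (zeta R i : vec R G n).
Proof.
apply/l2P => j; apply: (@sqsum_fin _ _ [fset 1%g]%fset) => g.
by rewrite inE /zeta => /negPf ->; rewrite andbF.
Qed.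

Lemma inner_zeta n (u : vec R G n) i : inner u (zeta R i) = u i 1%g.
Proof.
rewrite innerE (bigD1 i) //= big1 ?addr0 => [|j ji].
  have z0 g : g \notin [fset 1%g]%fset -> u i g * (zeta R i i g)^* = 0.
    by rewrite inE /zeta => /negPf ->; rewrite andbF rmorph0 mulr0.
  have := hasum_fin z0.
  by rewrite big_seq_fset1 {2}/zeta !eqxx /= rmorph1 mulr1; exact: ip_unique.
have z0 g : g \notin fset0 -> u j g * (zeta R i j g)^* = 0.
  by rewrite /zeta (negPf ji) rmorph0 mulr0.
by have := hasum_fin z0; rewrite big_nil; exact: ip_unique.
Qed.

Lemma vN_dim_kerE m n (T : 'M[{malg int[G]}]_(m, n)) d :
  kerdim T d -> vN_dim_ker R T = d%:C.
Proof.
move=> [y [hy <-]]; apply: eq_bigr => i _; have [yK y0] := hy i.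
by rewrite (orth_projE (l2_zeta i) yK y0) inner_zeta.
Qed.

Definition vcat n1 n2 (u : vec R G n1) (v : vec R G n2) : vec R G (n1 + n2) :=
  fun j => match fintype.split j with inl k => u k | inr k => v k end.

Lemma gract0 (f : G -> R[i]) : gract 0 f =1 fun=> 0.
Proof. by move=> g; rewrite /gract msupp0 big_nil. Qed.

Lemma inner_cat n1 n2 (u v : vec R G (n1 + n2)) :
  inner u v = inner (fun i => u (lshift n2 i)) (fun i => v (lshift n2 i)) +
              inner (fun i => u (rshift n1 i)) (fun i => v (rshift n1 i)).
Proof. by rewrite !innerE big_split_ord. Qed.

Lemma l2ker_block m1 n1 m2 n2 (T1 : 'M[{malg int[G]}]_(m1, n1))
    (T2 : 'M[{malg int[G]}]_(m2, n2)) (v : vec R G (n1 + n2)) :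
  l2ker (block_mx T1 0 0 T2) v <->
  l2ker T1 (fun i => v (lshift n2 i)) /\ l2ker T2 (fun i => v (rshift n1 i)).
Proof.
have act1 i g : mxact (block_mx T1 0 0 T2) v (lshift m2 i) g =
    mxact T1 (fun i => v (lshift n2 i)) i g.
  rewrite /mxact big_split_ord /= [X in _ + X]big1 ?addr0 => [|j _].
    by apply: eq_bigr => j _; rewrite block_mxEul.
  by rewrite block_mxEur mxE gract0.
have act2 i g : mxact (block_mx T1 0 0 T2) v (rshift m1 i) g =
    mxact T2 (fun i => v (rshift n1 i)) i g.
  rewrite /mxact big_split_ord /= [X in X + _]big1 ?add0r => [|j _].
    by apply: eq_bigr => j _; rewrite block_mxEdr.
  by rewrite block_mxEdl mxE gract0.
split=> [[v2 v0]|[[u2 u0] [w2 w0]]].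
  split; split.
  - by move=> i; exact: v2.
  - by move=> i g; rewrite -act1.
  - by move=> i; exact: v2.
  - by move=> i g; rewrite -act2.
split=> i.
  by rewrite -(splitK i); case: (fintype.split i) => k /=; [exact: u2|exact: w2].
by move=> g; rewrite -(splitK i); case: (fintype.split i) => k /=; rewrite (act1, act2).
Qed.

(** The kernel of a block diagonal matrix is the product of the two kernels, so the projection of a
    basis vector is the old one padded with zeros. *)
Lemma kerdim_block m1 n1 m2 n2 (T1 : 'M[{malg int[G]}]_(m1, n1))
    (T2 : 'M[{malg int[G]}]_(m2, n2)) d1 d2 :
  kerdim T1 d1 -> kerdim T2 d2 -> kerdim (block_mx T1 0 0 T2) (d1 + d2).
Proof.
move=> [y1 [h1 e1]] [y2 [h2 e2]].
have ker0 m n (T : 'M[{malg int[G]}]_(m, n)) : l2ker T (fun _ _ => 0 : R[i]).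
  split=> [|i g]; first by apply/l2P => i; exact: sqsum0.
  by rewrite /mxact big1 // => j _; rewrite /gract big1 // => h _; rewrite mul0rz.
have splitl i : fintype.split (lshift n2 i : 'I_(n1 + n2)) = inl i.
  exact: (unsplitK (inl i)).
have splitr i : fintype.split (rshift n1 i : 'I_(n1 + n2)) = inr i.
  exact: (unsplitK (inr i)).
have catlE (u : vec R G n1) (v : vec R G n2) i : vcat u v (lshift n2 i) = u i.
  by rewrite /vcat splitl.
have catrE (u : vec R G n1) (v : vec R G n2) i : vcat u v (rshift n1 i) = v i.
  by rewrite /vcat splitr.
have catl (u : vec R G n1) (v : vec R G n2) : (fun i => vcat u v (lshift n2 i)) = u.
  by apply/funext => i; exact: catlE.
have catr (u : vec R G n1) (v : vec R G n2) : (fun i => vcat u v (rshift n1 i)) = v.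
  by apply/funext => i; exact: catrE.
exists (fun i => match fintype.split i with
  | inl k => vcat (y1 k) (fun _ _ => 0) | inr k => vcat (fun _ _ => 0) (y2 k) end).
split=> [i|]; last first.
  rewrite rmorphD /= big_split_ord -e1 -e2; congr (_ + _); apply: eq_bigr => i _.
    by rewrite splitl catlE.
  by rewrite splitr catrE.
case: (split_ordP i) => k ->; split.
- by apply/l2ker_block; rewrite catl catr; split => //; exact: (h1 k).1.
- move=> z /l2ker_block[z1 z2]; rewrite inner_cat.
  apply: (etrans _ (addr0 0)); congr (_ + _).
    rewrite -[RHS]((h1 k).2 _ z1); congr inner; apply/funext => j; apply/funext => g.
    by rewrite /vsub /zeta eq_lshift catlE.
  rewrite innerE big1 // => j _; rewrite -[RHS](ip0l (z (rshift n1 j))).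
  by congr ip; apply/funext => g; rewrite /vsub /zeta eq_rlshift catrE subr0.
- by apply/l2ker_block; rewrite catl catr; split => //; exact: (h2 k).1.
- move=> z /l2ker_block[z1 z2]; rewrite inner_cat.
  apply: (etrans _ (addr0 0)); congr (_ + _); last first.
    rewrite -[RHS]((h2 k).2 _ z2); congr inner; apply/funext => j; apply/funext => g.
    by rewrite /vsub /zeta eq_rshift catrE.
  rewrite innerE big1 // => j _; rewrite -[RHS](ip0l (z (lshift n2 j))).
  by congr ip; apply/funext => g; rewrite /vsub /zeta eq_lrshift catlE subr0.
Qed.

Definition is_kerdim (d : R) := exists m n (T : 'M[{malg int[G]}]_(m, n)), kerdim T d.

Lemma is_kerdimD d1 d2 : is_kerdim d1 -> is_kerdim d2 -> is_kerdim (d1 + d2).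
Proof.
move=> [m1 [n1 [T1 h1]]] [m2 [n2 [T2 h2]]].
by exists (m1 + m2)%N, (n1 + n2)%N, (block_mx T1 0 0 T2); exact: kerdim_block.
Qed.

Lemma is_kerdim0 : is_kerdim 0.
Proof.
exists 0%N, 0%N, 0, (fun _ _ _ => 0); split=> [[]//|].
by rewrite big_ord0.
Qed.

Lemma is_kerdimMn d k : is_kerdim d -> is_kerdim (k%:R * d).
Proof.
move=> hd; elim: k => [|k IH]; first by rewrite mul0r; exact: is_kerdim0.
by rewrite -natr1 mulrDl mul1r; exact: is_kerdimD.
Qed.

End KernelDimension.

(** * Averaging over a lamp *)

Section LeftTranslations.
Variables (R : realType) (G : groupType).
Implicit Types (f : G -> R[i]) (g h k : G).

Definition ltr h f : G -> R[i] := fun g => f (h^-1 * g)%g.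

Lemma ltrM h k f : ltr h (ltr k f) = ltr (h * k)%g f.
Proof. by apply/funext => g; rewrite /ltr invgM mulgA. Qed.

Lemma ltr1 f : ltr 1%g f = f.
Proof. by apply/funext => g; rewrite /ltr invg1 mul1g. Qed.

Lemma sqsum_ltr h f : sqsum f -> sqsum (ltr h f).
Proof.
apply: (@sqsum_inj _ _ (fun g => h^-1 * g)%g (fun g => h * g)%g) => g.
by rewrite mulgA mulgV mul1g.
Qed.

Lemma ip_ltr h f1 f2 : sqsum f1 -> sqsum f2 ->
  ip (ltr h f1) f2 = ip f1 (ltr h^-1 f2).
Proof.
move=> h1 h2; apply: ip_unique.
have := hasum_inj (phi := fun g => (h^-1 * g)%g) (psi := fun g => (h * g)%g) _ _
  (ipP h1 (sqsum_ltr h^-1 h2)).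
have -> : ((fun g => f1 g * (ltr h^-1 f2 g)^*) \o (fun g => (h^-1 * g)%g)) =
    (fun g => ltr h f1 g * (f2 g)^*).
  by apply/funext => g; rewrite /ltr /= invgK mulgA mulgV mul1g.
by apply=> g; rewrite mulgA ?mulgV ?mulVg mul1g.
Qed.

Definition dl h : G -> R[i] := fun g => (g == h)%:R.

Lemma sqsum_dl h : sqsum (dl h).
Proof.
by apply: (@sqsum_fin _ _ [fset h]%fset) => g; rewrite inE /dl => /negPf ->.
Qed.

Lemma ip_dl f h : ip f (dl h) = f h.
Proof.
have z0 g : g \notin [fset h]%fset -> f g * (dl h g)^* = 0.
  by rewrite inE /dl => /negPf ->; rewrite rmorph0 mulr0.
apply: ip_unique; have := hasum_fin z0.
by rewrite big_seq_fset1 {2}/dl eqxx rmorph1 mulr1.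
Qed.

Lemma gractEw (a : {malg int[G]}) (D : {fset G}) f g : (msupp a `<=` D)%fset ->
  gract a f g = \sum_(h <- D) f (h^-1 * g)%g *~ a@_h.
Proof.
move=> aD; rewrite /gract (big_fset_incl _ aD) // => h _ /mcoeff_outdom ->.
by rewrite mulr0z.
Qed.

Lemma gractD (a b : {malg int[G]}) f g : gract (a + b) f g = gract a f g + gract b f g.
Proof.
rewrite (gractEw _ _ (msuppD_le a b)) (@gractEw a _ _ _ (fsubsetUl _ (msupp b))).
rewrite (@gractEw b _ _ _ (fsubsetUr (msupp a) _)) -big_split; apply: eq_bigr => h _.
by rewrite mcoeffD mulrzDr.
Qed.

Lemma gractMz (a : {malg int[G]}) (n : int) f g : gract (a *~ n) f g = gract a f g *~ n.
Proof.
have gN (b : {malg int[G]}) : gract (- b) f g = - gract b f g.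
  by apply: (addIr (gract b f g)); rewrite -gractD !addNr gract0.
have gn (b : {malg int[G]}) (k : nat) : gract (b *+ k) f g = gract b f g *+ k.
  by elim: k => [|k IH]; rewrite ?gract0 // !mulrS gractD IH.
by case: n => k; rewrite ?NegzE ?mulrNz ?gN -!pmulrn gn.
Qed.

Lemma gractU h f g : gract << h >> f g = ltr h f g.
Proof.
rewrite (@gractEw _ [fset h]%fset) ?msuppU_le // big_seq_fset1 mcoeffU eqxx.
by rewrite mulr1n mulr1z.
Qed.

Lemma gract_sum (J : Type) (r : seq J) (a : J -> {malg int[G]}) f g :
  gract (\sum_(j <- r) a j) f g = \sum_(j <- r) gract (a j) f g.
Proof.
elim: r => [|j r IH]; first by rewrite !big_nil gract0.
by rewrite !big_cons gractD IH.
Qed.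

End LeftTranslations.

Section LampProjections.
Variables (R : realType) (A : finZmodType).
Notation G := (wreathZ A).
Implicit Types (f : G -> R[i]) (j k n : int) (w : seq (int * bool)).

Definition lamp j (c : A) : G := (0, << c *g j >>).
Definition trans n : G := (n, 0).

Lemma shift0 n : shift n (0 : {malg A[int]}) = 0.
Proof. by apply/malgP => i; rewrite !(shiftE, mcoeff0). Qed.

Lemma shift_id (a : {malg A[int]}) : shift 0 a = a.
Proof. by apply/malgP => i; rewrite shiftE subr0. Qed.

Lemma shiftU n j (c : A) : shift n << c *g j >> = << c *g j + n >>.
Proof.
apply/malgP => i; rewrite shiftE !mcoeffU.
by rewrite -(inj_eq (addIr n)) subrK.
Qed.

Lemma mulE (x y : G) : (x * y)%g = (x.1 + y.1, x.2 + shift x.1 y.2).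
Proof. by []. Qed.

Lemma invE (x : G) : (x^-1)%g = (- x.1, - shift (- x.1) x.2).
Proof. by []. Qed.

Lemma lampD j c c' : (lamp j c * lamp j c')%g = lamp j (c + c').
Proof. by rewrite mulE /lamp /= addr0 shift_id monalgUD. Qed.

Lemma lampC j k c c' : (lamp j c * lamp k c')%g = (lamp k c' * lamp j c)%g.
Proof. by rewrite !mulE /lamp /= !addr0 !shift_id addrC. Qed.

Lemma lampV j c : ((lamp j c)^-1)%g = lamp j (- c).
Proof. by rewrite invE /lamp /= oppr0 shift_id monalgUN. Qed.

Lemma trans_lamp n j c : (trans n * lamp j c)%g = (lamp (j + n) c * trans n)%g.
Proof. by rewrite !mulE /trans /lamp /= shiftU shift0 !add0r !addr0. Qed.

Lemma transD n m : (trans n * trans m)%g = trans (n + m).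
Proof. by rewrite mulE /trans /= shift0 addr0. Qed.

Lemma trans0 : trans 0 = 1%g.
Proof. by []. Qed.

Lemma transV n : ((trans n)^-1)%g = trans (- n).
Proof. by rewrite invE /trans /= shift0 oppr0. Qed.

Let N : R[i] := #|A|%:R.

Lemma card_neq0 : N != 0.
Proof. by rewrite pnatr_eq0 -lt0n; apply/card_gt0P; exists 0. Qed.

Definition avg j f : G -> R[i] := fun x => N^-1 * \sum_(c : A) ltr (lamp j c) f x.

(* (j, false) stands for the projection onto the functions constant in the    *)
(* lamp j, and (j, true) for the complementary projection.                    *)
Definition letter (x : int * bool) f : G -> R[i] :=
  if x.2 then fun y => f y - avg x.1 f y else avg x.1 f.

Definition word w f := foldr letter f w.

Lemma avg_sum (J : Type) (r : seq J) (c : J -> R[i]) (F : J -> G -> R[i]) j x :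
  avg j (fun g => \sum_(k <- r) c k * F k g) x = \sum_(k <- r) c k * avg j (F k) x.
Proof.
rewrite /avg; under [in RHS]eq_bigr do rewrite mulrCA mulr_sumr.
rewrite -mulr_sumr exchange_big; congr (_ * _); apply: eq_bigr.
Qed.

Lemma letter_sum (J : Type) (r : seq J) (c : J -> R[i]) (F : J -> G -> R[i]) l x :
  letter l (fun g => \sum_(k <- r) c k * F k g) x =
  \sum_(k <- r) c k * letter l (F k) x.
Proof.
case: l => j [] /=; rewrite /letter /= avg_sum // -sumrB.
by apply: eq_bigr => k _; rewrite mulrBr.
Qed.

Lemma word_sum w (J : Type) (r : seq J) (c : J -> R[i]) (F : J -> G -> R[i]) x :
  word w (fun g => \sum_(k <- r) c k * F k g) x = \sum_(k <- r) c k * word w (F k) x.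
Proof.
elim: w x => //= l w IH x.
rewrite (_ : word w _ = fun g => \sum_(k <- r) c k * word w (F k) g).
  exact: letter_sum.
by apply/funext => y; exact: IH.
Qed.

Lemma avg_lamp j c f : ltr (lamp j c) (avg j f) = avg j f.
Proof.
apply/funext => x; rewrite /ltr /avg; congr (_ * _).
rewrite (reindex_inj (addrI (- c))) /=; apply: eq_bigr => d _.
rewrite /ltr mulgA; congr (f (_ * _)%g).
by rewrite !lampV lampD opprD opprK addrC addKr.
Qed.

Lemma avgK j f : avg j (avg j f) = avg j f.
Proof.
apply/funext => x; rewrite {1}/avg.
under eq_bigr do rewrite avg_lamp.
by rewrite sumr_const -mulr_natl mulKf // card_neq0.
Qed.

Lemma avgC j k f : avg j (avg k f) = avg k (avg j f).
Proof.
apply/funext => x; rewrite /avg /ltr; congr (_ * _).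
rewrite -!mulr_sumr; congr (_ * _); rewrite exchange_big; apply: eq_bigr => c _.
by apply: eq_bigr => d _; rewrite !mulgA !lampV lampC.
Qed.

Lemma avg_trans n j f : ltr (trans n) (avg j f) = avg (j + n) (ltr (trans n) f).
Proof.
apply/funext => x; rewrite /avg /ltr; congr (_ * _); apply: eq_bigr => c _.
by rewrite !mulgA; congr (f (_ * _)%g); rewrite -!invgM trans_lamp.
Qed.

Lemma avgB j f g : avg j (fun x => f x - g x) = fun x => avg j f x - avg j g x.
Proof. by apply/funext => x; rewrite /avg -mulrBr sumrB. Qed.

Lemma letterC l1 l2 f : letter l1 (letter l2 f) = letter l2 (letter l1 f).
Proof.
case: l1 l2 => [j []] [k []]; rewrite /letter /= ?avgB (avgC j k) //.
by apply/funext => x; ring.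
Qed.

Lemma letterK l f : letter l (letter l f) = letter l f.
Proof.
case: l => j []; rewrite /letter /= ?avgB avgK //.
by apply/funext => x; ring.
Qed.

Lemma letter_neg j b f : letter (j, b) (letter (j, ~~ b) f) = fun=> 0.
Proof.
by case: b; rewrite /letter /= ?avgB avgK; apply/funext => x; rewrite subrr.
Qed.

Lemma letter_split j f x : f x = letter (j, false) f x + letter (j, true) f x.
Proof. by rewrite /letter /= addrC subrK. Qed.

Lemma letter_trans n j b f :
  ltr (trans n) (letter (j, b) f) = letter (j + n, b) (ltr (trans n) f).
Proof. by case: b; rewrite /letter /= -avg_trans. Qed.

Lemma word_letterC w l f : word w (letter l f) = letter l (word w f).
Proof. by elim: w => //= l' w ->; rewrite letterC. Qed.

Lemma wordC w1 w2 f : word w1 (word w2 f) = word w2 (word w1 f).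
Proof. by elim: w1 => //= l w1 ->; rewrite word_letterC. Qed.

Lemma letter_word l w f : l \in w -> letter l (word w f) = word w f.
Proof.
elim: w => //= l' w IH; rewrite inE => /orP[/eqP->|/IH h]; first exact: letterK.
by rewrite letterC h.
Qed.

Lemma letter_word0 j b w f : (j, ~~ b) \in w -> letter (j, b) (word w f) = fun=> 0.
Proof. by move=> /letter_word <-; rewrite letter_neg. Qed.

Lemma word_sub w1 w2 f : {subset w1 <= w2} -> word w1 (word w2 f) = word w2 f.
Proof.
elim: w1 => //= l w1 IH h; rewrite IH; last by move=> x xw; apply: h; rewrite inE xw orbT.
by apply: letter_word; apply: h; rewrite mem_head.
Qed.

Lemma eq_word w1 w2 f : w1 =i w2 -> word w1 f = word w2 f.
Proof.
move=> e; rewrite -(@word_sub w2 w1 f) => [|x]; last by rewrite e.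
by rewrite wordC word_sub // => x; rewrite e.
Qed.

Lemma sqsum_avg j f : sqsum f -> sqsum (avg j f).
Proof. by move=> hf; apply: sqsumZ; apply: sqsum_sum => c _; exact: sqsum_ltr. Qed.

Lemma sqsum_letter l f : sqsum f -> sqsum (letter l f).
Proof.
case: l => j [] hf; rewrite /letter /=; last exact: sqsum_avg.
by apply: sqsumB => //; exact: sqsum_avg.
Qed.

Lemma sqsum_word w f : sqsum f -> sqsum (word w f).
Proof. by move=> hf; elim: w => //= l w; exact: sqsum_letter. Qed.

Lemma ip_avg j f g : sqsum f -> sqsum g -> ip (avg j f) g = ip f (avg j g).
Proof.
move=> hf hg; have hl h u : sqsum u -> sqsum (ltr h u) by exact: sqsum_ltr.
rewrite /avg ipZl ?ipZr //; try by apply: sqsum_sum => c _; exact: hl.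
rewrite fmorphV /= conjC_nat; congr (_ * _).
rewrite ip_suml // => [|c _]; last exact: hl.
rewrite (ipC _ hf) ?ip_suml //; [|by move=> c _; exact: hl|
  by apply: sqsum_sum => c _; exact: hl].
rewrite rmorph_sum /= (reindex_inj oppr_inj) /=; apply: eq_bigr => c _.
by rewrite -ipC ?ip_ltr ?lampV ?opprK //; exact: hl.
Qed.

Lemma ip_letter l f g : sqsum f -> sqsum g -> ip (letter l f) g = ip f (letter l g).
Proof.
move=> hf hg; case: l => j [] /=; rewrite /letter /=; last exact: ip_avg.
have e u : (fun x => u x - avg j u x) = (fun x => u x + (-1) * avg j u x).
  by apply/funext => x; rewrite mulN1r.
have ha u : sqsum u -> sqsum (avg j u) by exact: sqsum_avg.
have hz u : sqsum u -> sqsum (fun x => -1 * avg j u x).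
  by move=> hu; apply: sqsumZ; exact: ha.
rewrite !e ipDl ?ipDr //; [|exact: hz|exact: hz].
by rewrite (ipZl _ (ha _ hf) hg) (ipZr _ (ha _ hg) hf) ip_avg // rmorphN rmorph1.
Qed.

Lemma ip_word w f g : sqsum f -> sqsum g -> ip (word w f) g = ip f (word w g).
Proof.
move=> hf hg; elim: w g hg => //= l w IH g hg.
rewrite ip_letter ?IH ?word_letterC //; first exact: sqsum_letter.
exact: sqsum_word.
Qed.

Lemma nsq_letter l f : sqsum f -> nsq (letter l f) <= nsq f.
Proof.
have e j b u : sqsum u -> ip (letter (j, b) u) (letter (j, b) u) = ip u (letter (j, b) u).
  by move=> hu; rewrite ip_letter ?letterK //; exact: sqsum_letter.
move=> hf; case: l => j b.
have := sqsum_letter (j, b) hf; have := sqsum_letter (j, ~~ b) hf => h1 h2.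
rewrite -lecR -!ipff // e //.
have -> : ip f f = ip f (letter (j, b) f) + ip f (letter (j, ~~ b) f).
  rewrite -ipDr //; congr ip; apply/funext => x.
  by rewrite [LHS](letter_split j); case: b {h1 h2} => //; rewrite addrC.
by rewrite lerDl -e // ipff // ler0c nsq_ge0.
Qed.

Lemma nsq_word w f : sqsum f -> nsq (word w f) <= nsq f.
Proof.
move=> hf; elim: w => //= l w; apply: le_trans; apply: nsq_letter; exact: sqsum_word.
Qed.

(** Right translations commute with the averages, which act from the left, and carry the indicator
    of 1 to that of any other element. *)
Definition rtr (h : G) f : G -> R[i] := fun x => f (x * h)%g.

Lemma word_rtr w h f : word w (rtr h f) = rtr h (word w f).
Proof.
elim: w => //= -[j b] w ->; have a u : avg j (rtr h u) = rtr h (avg j u).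
  apply/funext => x; rewrite /avg /rtr /ltr; congr (_ * _).
  by apply: eq_bigr => c _; rewrite mulgA.
by rewrite /letter; case: b; rewrite /= a.
Qed.

(** The averages only change lamps at positions of [w]; from the identity they never reach an
    element whose lamp at another position is on or whose Z-coordinate is nonzero. *)
Lemma word_dl_support w (x : G) j : j \notin map fst w ->
  x.1 != 0 \/ x.2@_j != 0 -> word w (dl R 1%g) x = 0.
Proof.
elim: w x => [|[k b] w IH] x /=.
  move=> _ hx; rewrite /dl; case: eqP => // x1; case: hx; rewrite x1 ?eqxx //.
  by have -> : (1%g : G).2 = 0 by []; rewrite mcoeff0 eqxx.
rewrite inE negb_or => /andP[jk jw] hx.
have avg0 : avg k (word w (dl R 1%g)) x = 0.
  rewrite /avg big1 ?mulr0 // => c _; apply: IH => //.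
  rewrite lampV mulE /lamp /= add0r shift_id mcoeffD mcoeffU (eq_sym k) (negPf jk).
  by rewrite mulr0n add0r.
by case: b; rewrite /letter /= ?avg0 ?subr0 //; exact: IH.
Qed.

Definition prob w : R :=
  \prod_(l <- w) (if l.2 then 1 - #|A|%:R^-1 else #|A|%:R^-1).

(** Independence of the letters at distinct positions: in the average at a new position only the
    term c = 0 has a nonzero value at the identity, by [word_dl_support], and it brings the factor
    1/#|A|. *)
Lemma word_dl w : uniq (map fst w) -> word w (dl R 1%g) 1%g = (prob w)%:C.
Proof.
elim: w => [_|[j b] w IH /= /andP[jw uw]].
  by rewrite /prob big_nil /= /dl eqxx rmorph1.
have avgE : avg j (word w (dl R 1%g)) 1%g = (#|A|%:R^-1)%:C * (prob w)%:C.
  rewrite /avg (bigD1 0) //= big1 ?addr0 => [|c c0].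
    rewrite fmorphV rmorph_nat -IH //; congr (_ * _); congr (word _ _ _).
    by rewrite /ltr mulg1 lampV oppr0 /lamp monalgU0.
  apply: (word_dl_support jw); right.
  rewrite mulg1 lampV /lamp /= mcoeffU eqxx mulr1n oppr_eq0; exact: c0.
rewrite /letter /prob big_cons /= -/(prob w); case: b => /=; last by rewrite avgE rmorphM.
by rewrite avgE IH // rmorphM rmorphB rmorph1 mulrBl mul1r.
Qed.

End LampProjections.

(** * Local rules as integral matrices *)

Section LocalRules.
Variables (R : realType) (A : finZmodType).
Notation G := (wreathZ A).

(* A rule is a linear relation, on the range of the projection (rpos, rbit),  *)
(* between the components of a vector, with coefficients rnow, and those of   *)
(* its translate by trans (-1), with coefficients rprev.                      *)
Record rule n := Rule {
  rpos : int; rbit : bool; rnow : 'I_n -> int; rprev : 'I_n -> int }.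

(** [#|A|] times the projection [letter l], applied after left translation by [h]. The factor makes
    the coefficients integral and leaves kernels unchanged. *)
Definition letter_malg (l : int * bool) (h : G) : {malg int[G]} :=
  let s := \sum_(c : A) << (lamp l.1 c * h)%g >> in
  if l.2 then << h >> *~ #|A| - s else s.

Lemma gract_letter_malg l h (f : G -> R[i]) g :
  gract (letter_malg l h) f g = #|A|%:R * letter l (ltr h f) g.
Proof.
have e : gract (\sum_(c : A) << (lamp l.1 c * h)%g >>) f g =
    #|A|%:R * avg l.1 (ltr h f) g.
  rewrite gract_sum /avg mulrA mulfV ?card_neq0 // mul1r.
  by apply: eq_bigr => c _; rewrite gractU ltrM.
rewrite /letter_malg /letter; case: l.2 => //.
by rewrite gractD -mulrN1z !gractMz e gractU mulrBr mulrN1z -pmulrn !mulr_natl.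
Qed.

Definition rule_mx m n (r : 'I_m -> rule n) : 'M[{malg int[G]}]_(m, n) :=
  \matrix_(k < m, i < n)
    (letter_malg (rpos (r k), rbit (r k)) 1%g *~ rnow (r k) i +
     letter_malg (rpos (r k), rbit (r k)) (trans A (-1)) *~ rprev (r k) i).

Definition rule_sum n (r : rule n) (s : int) (z : vec R G n) : G -> R[i] :=
  fun g => \sum_i (rnow r i)%:~R * ltr (trans A s) (z i) g +
           \sum_i (rprev r i)%:~R * ltr (trans A (s - 1)) (z i) g.

Lemma letterD l (f1 f2 : G -> R[i]) x :
  letter l (fun g => f1 g + f2 g) x = letter l f1 x + letter l f2 x.
Proof.
have := @letter_sum R A _ [:: f1; f2] (fun=> 1) id l x.
rewrite !big_cons !big_nil !mul1r !addr0 => <-; congr (letter _ _ _).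
by apply/funext => g; rewrite !big_cons !big_nil !mul1r !addr0.
Qed.

Lemma mxact_rule m n (r : 'I_m -> rule n) (z : vec R G n) k g :
  mxact (rule_mx r) z k g =
  #|A|%:R * letter (rpos (r k), rbit (r k)) (rule_sum (r k) 0 z) g.
Proof.
rewrite /mxact /rule_sum letterD !letter_sum mulrDr !mulr_sumr -big_split.
apply: eq_bigr => i _.
rewrite mxE; have e h := gract_letter_malg (rpos (r k), rbit (r k)) h (z i) g.
move: (letter_malg _ 1%g) (e 1%g) (letter_malg _ (trans A (-1))) (e (trans A (-1))).
move=> a ea b eb; rewrite gractD !gractMz ea eb sub0r trans0 !ltr1.
have c (n0 : int) (N y : R[i]) : N * y *~ n0 = N * (n0%:~R * y).
  by rewrite -mulrzr -mulrA [y * _]mulrC.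
by rewrite !c.
Qed.

Lemma l2ker_rule m n (r : 'I_m -> rule n) (z : vec R G n) :
  l2ker (rule_mx r) z <-> l2 z /\
    forall k, letter (rpos (r k), rbit (r k)) (rule_sum (r k) 0 z) = fun=> 0.
Proof.
split=> -[z2 z0]; split => // k.
  apply/funext => g; have := z0 k g; rewrite mxact_rule => /eqP.
  by rewrite mulf_eq0 (negPf (card_neq0 R A)) => /eqP.
by move=> g; rewrite mxact_rule z0 mulr0.
Qed.

(** Translation by [s] moves the tested letter to [rpos (r k) + s]. A word that contains this letter
    absorbs the test, so after applying it the rule is an exact linear relation between entries. *)
Lemma word_rule m n (r : 'I_m -> rule n) (z : vec R G n) k s w x :
  l2ker (rule_mx r) z -> (rpos (r k) + s, rbit (r k)) \in w ->
  \sum_i (rnow (r k) i)%:~R * word w (ltr (trans A s) (z i)) x +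
  \sum_i (rprev (r k) i)%:~R * word w (ltr (trans A (s - 1)) (z i)) x = 0.
Proof.
move=> /l2ker_rule[_ /(_ k) h0] hw.
have hs : ltr (trans A s) (rule_sum (r k) 0 z) = rule_sum (r k) s z.
  apply/funext => g; rewrite /rule_sum /ltr; congr (_ + _); apply: eq_bigr => i _.
    by rewrite trans0 invg1 mul1g.
  by rewrite mulgA -invgM transD sub0r.
have h1 : letter (rpos (r k) + s, rbit (r k)) (rule_sum (r k) s z) = fun=> 0.
  by rewrite -hs -letter_trans h0; apply/funext.
have h2 : word w (rule_sum (r k) s z) = fun=> 0.
  rewrite -(letter_word _ hw) -word_letterC h1.
  apply/funext => y; have := @word_sum R A w nat [::] (fun=> 0) (fun=> fun=> 0) y.
  by rewrite !big_nil.
rewrite -[RHS](congr1 (fun f => f x) h2) /rule_sum.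
pose c (i : 'I_n + 'I_n) := match i with
  | inl i => (rnow (r k) i)%:~R | inr i => (rprev (r k) i)%:~R end : R[i].
pose F (i : 'I_n + 'I_n) := match i with
  | inl i => ltr (trans A s) (z i) | inr i => ltr (trans A (s - 1)) (z i) end.
have := @word_sum R A w _ (index_enum ('I_n + 'I_n)%type) c F x.
rewrite big_sumType /= => <-; congr (word _ _ _).
by apply/funext => g; rewrite big_sumType.
Qed.

Definition prefix_word (w : seq bool) : seq (int * bool) :=
  [seq (k%:Z, nth false w k) | k <- iota 0 (size w)].

(** Each rule kills the wrong letter at one position of [w], so the kernel is the range of the
    projection given by [w], and its dimension is the trace of that projection. *)
Lemma is_kerdim_word (w : seq bool) :
  is_kerdim G (\prod_(b <- w) (if b then 1 - #|A|%:R^-1 else #|A|%:R^-1 : R)).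
Proof.
pose r (k : 'I_(size w)) : rule 1 :=
  @Rule 1 k%:Z (~~ nth false w k) (fun=> 1) (fun=> 0).
have rsum k (z : vec R G 1) : rule_sum (r k) 0 z = z ord0.
  apply/funext => g; rewrite /rule_sum !big_ord1 /= mulr1z mulr0z.
  by rewrite mul1r mul0r addr0 trans0 ltr1.
pose pw := prefix_word w.
exists (size w), 1%N, (rule_mx r), (fun i j => word pw (dl R 1%g)).
have pw_uniq : uniq (map fst pw).
  rewrite -map_comp map_inj_uniq ?iota_uniq // => a b /= []; exact.
split=> [i|]; last first.
  rewrite big_ord1 word_dl //; congr (_ %:C).
  by rewrite /prob big_map -[in RHS](mkseq_nth false w) big_map.
split.
  apply/l2ker_rule; split=> [|k]; first by apply/l2P => _; apply/sqsum_word/sqsum_dl.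
  rewrite rsum; apply: letter_word0; rewrite /= negbK.
  by apply/mapP; exists (k : nat); rewrite ?mem_iota ?add0n /=.
move=> z /l2ker_rule[/l2P z2 z0].
have wz : word pw (z ord0) = z ord0.
  have : {subset pw <= pw} by [].
  elim: {1 3}pw => //= l v IH hv.
  have /mapP[k kw ->] : l \in pw by apply: hv; rewrite mem_head.
  rewrite IH => [|x xv]; last by apply: hv; rewrite inE xv orbT.
  move: kw; rewrite mem_iota /= => kw; have := z0 (Ordinal kw); rewrite rsum /= => h.
  apply/funext => g; rewrite [RHS](letter_split k) -[LHS]addr0.
  have := congr1 (fun f => f g) h; case: (nth false w k) => /= ->; last by [].
  by rewrite add0r addr0.
rewrite innerE big_ord1.
have -> : vsub (zeta R i : vec R G 1) (fun=> word pw (dl R 1%g)) ord0 =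
    (fun g : G => dl R 1%g g + (-1) * word pw (dl R 1%g) g).
  by apply/funext => g; rewrite /vsub /zeta mulN1r /dl (ord1 i).
have d2 := sqsum_dl R (1%g : G); have w2 := sqsum_word pw d2.
by rewrite ipDl ?ipZl //; [rewrite ip_word // wz mulN1r subrr|exact: sqsumZ].
Qed.

End LocalRules.

(** * Scanning for runs of ones *)

Section Scanning.
Variables (R : realType) (F : seq (int * bool) -> R[i]) (M : nat) (rho : R).
Implicit Types (u w : seq (int * bool)) (c s : int).

Hypothesis F_split : forall j w, F w = F ((j, false) :: w) + F ((j, true) :: w).
Hypothesis F_mem : forall w1 w2, w1 =i w2 -> F w1 = F w2.
Hypothesis F_small : forall w s,
  (forall k, (k < M)%N -> (s + k%:Z, true) \in w) -> normc (F w) <= rho.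

Definition ones (pos : nat -> int) n : seq (int * bool) :=
  [seq (pos k, true) | k <- iota 0 n].

Lemma mem_ones pos n x :
  reflect (exists2 k, (k < n)%N & x = (pos k, true)) (x \in ones pos n).
Proof.
apply: (iffP mapP) => [[k]|[k kn ->]]; first by rewrite mem_iota => kn ->; exists k.
by exists k; rewrite ?mem_iota.
Qed.

Lemma mem_ones_right c n j b :
  ((j, b) \in ones (fun k => c + k%:Z) n) = [&& b, c <= j & j < c + n%:Z].
Proof.
apply/mem_ones/and3P => [[k kn [-> ->]]|[bT cj jn]]; first by split=> //; lia.
by exists `|j - c|%N; [lia|rewrite bT; congr pair; lia].
Qed.

Lemma mem_ones_left c n j b :
  ((j, b) \in ones (fun k => c - k%:Z) n) = [&& b, j <= c & c - n%:Z < j].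
Proof.
apply/mem_ones/and3P => [[k kn [-> ->]]|[bT cj jn]]; first by split=> //; lia.
by exists `|c - j|%N; [lia|rewrite bT; congr pair; lia].
Qed.

(** [F w] is meant as the value at the identity of a component to which the word [w] has been
    applied, and [rho] bounds it when [w] contains M consecutive ones. The sum sorts by the first
    zero met along [pos]; the last term stands for n ones in a row. *)
Lemma scan (pos : nat -> int) u n : F u =
  \sum_(0 <= m < n) F ((pos m, false) :: ones pos m ++ u) + F (ones pos n ++ u).
Proof.
elim: n => [|n IH]; first by rewrite big_geq // add0r.
rewrite {}IH big_nat_recr // -addrA; congr (_ + _).
rewrite [LHS](F_split (pos n)); congr (_ + _); apply: F_mem => x.
have en : iota 0 n.+1 = iota 0 n ++ [:: n] by rewrite -addn1 iotaD.
rewrite /ones en map_cat -catA inE !mem_cat inE.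
by rewrite orbCA.
Qed.

Lemma scan_right u s :
  normc (F u - \sum_(0 <= m < M)
    F ((s + m%:Z, false) :: ones (fun k => s + k%:Z) m ++ u)) <= rho.
Proof.
rewrite {1}(scan (fun k => s + k%:Z) u M) addrC addKr; apply: (@F_small _ s) => k kM.
by rewrite mem_cat; apply/orP; left; apply/mem_ones; exists k.
Qed.

Lemma scan_left u s :
  normc (F u - \sum_(0 <= m < M)
    F ((s - m%:Z, false) :: ones (fun k => s - k%:Z) m ++ u)) <= rho.
Proof.
rewrite {1}(scan (fun k => s - k%:Z) u M) addrC addKr.
apply: (@F_small _ (s - M%:Z + 1)) => k kM.
rewrite mem_cat; apply/orP; left; apply/mem_ones; exists (M - k.+1)%N; first by lia.
by congr pair; lia.
Qed.

Definition run c n : seq (int * bool) :=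
  [:: (c, false), (c + n.+1%:Z, false) & ones (fun k => c + 1 + k%:Z) n].

Lemma normc_sum_le (J : eqType) (r : seq J) (P : pred J) (f : J -> R[i]) (e : R) :
  (forall j, j \in r -> P j -> normc (f j) <= e) ->
  normc (\sum_(j <- r | P j) f j) <= \sum_(j <- r | P j) e.
Proof.
elim: r => [|j r IH] h; first by rewrite !big_nil normc0.
have {}IH := IH (fun j jr => h j (mem_behead (s := _ :: _) jr)).
rewrite !big_cons; case: ifP => Pj //; apply: le_trans (le_normcD _ _) _.
by rewrite lerD // h // mem_head.
Qed.

Lemma triangle_exchange (f : nat -> nat -> R[i]) :
  \sum_(0 <= m < M) \sum_(0 <= r < M - m) f m (m + r)%N =
  \sum_(0 <= l < M) \sum_(0 <= m < l.+1) f m l.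
Proof.
have -> : \sum_(0 <= m < M) \sum_(0 <= r < M - m) f m (m + r)%N =
    \sum_(0 <= m < M) \sum_(0 <= l < M | (m <= l)%N) f m l.
  apply: eq_big_nat => m mM.
  rewrite [RHS]big_mkcond [RHS](@big_cat_nat _ _ _ m) /=; [|by []|by lia].
  rewrite [X in _ = X + _](_ : _ = 0) ?add0r; last first.
    by rewrite big_nat big1 // => l lm; case: ifP => //; lia.
  rewrite -[X in \sum_(X <= _ < M) _]add0n big_addn; apply: eq_big_nat => r _.
  by rewrite leq_addl addnC.
under eq_bigr do rewrite big_mkcond /=.
rewrite exchange_big; apply: eq_big_nat => l lM; rewrite -big_mkcond /=.
by rewrite (big_nat_widen 0 l.+1 M) //.
Qed.

(* The position 0 lies in a run of l ones preceded by a zero, at distance m   *)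
(* from that zero.                                                            *)
Lemma scan_run : normc (F [::] -
    \sum_(0 <= l < M) \sum_(0 <= m < l.+1) F (run (- m%:Z) l)) <= M.+1%:R * rho.
Proof.
have h0 := scan_left [::] 0.
pose u m := (0 - m%:Z, false) :: ones (fun k => 0 - k%:Z) m ++ [::].
have h1 m : (m < M)%N -> normc (F (u m) - \sum_(0 <= r < M - m)
    F (run (- m%:Z) (m + r))) <= rho.
  move=> mM; rewrite {1}(scan (fun k => 1 + k%:Z) (u m) (M - m)).
  rewrite [X in X + _ - _](_ : _ = \sum_(0 <= r < M - m) F (run (- m%:Z) (m + r))).
    rewrite addrC addKr.
    apply: (@F_small _ (1 - m%:Z)) => k kM.
    by rewrite mem_cat /u inE mem_cat mem_ones_right mem_ones_left /= !xpair_eqE /=; lia.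
  apply: eq_big_nat => r rM; apply: F_mem => -[j b].
  rewrite /run /u !inE !mem_cat !inE mem_cat !mem_ones_right mem_ones_left !xpair_eqE.
  by rewrite !in_nil; case: b => /=; lia.
rewrite -(triangle_exchange (fun m l => F (run (- m%:Z) l))).
have -> : F [::] - \sum_(0 <= m < M) \sum_(0 <= r < M - m) F (run (- m%:Z) (m + r)) =
    (F [::] - \sum_(0 <= m < M) F (u m)) + \sum_(0 <= m < M)
    (F (u m) - \sum_(0 <= r < M - m) F (run (- m%:Z) (m + r))).
  by rewrite sumrB addrA subrK.
apply: (le_trans (le_normcD _ _)); rewrite -natr1 mulrDl mul1r [leRHS]addrC lerD //.
apply: (@le_trans _ _ (\sum_(0 <= m < M) rho)).
  by apply: normc_sum_le => m; rewrite mem_index_iota => mM _; exact: h1.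
by rewrite sumr_const_nat subn0 mulr_natl.
Qed.

(** The word 0 1^a 0 1^b 0 placed from position [c] on; its zeros have the offsets 0, a + 1 and a +
    b + 2. *)
Definition block c a b : seq (int * bool) :=
  [seq (c + k%:Z, (k \notin [:: 0; a.+1; (a + b).+2])%N) | k <- iota 0 (a + b).+3].

Lemma mem_block c a b j i :
  ((j, i) \in block c a b) = [&& c <= j, j <= c + (a + b).+2%:Z &
    i == [&& j != c, j != c + a.+1%:Z & j != c + (a + b).+2%:Z]].
Proof.
apply/mapP/and3P => [[k]|[cj jn /eqP->]].
  rewrite mem_iota => kn [-> ->]; rewrite !inE; split; [lia|lia|].
  by apply/eqP; lia.
by exists `|j - c|%N; [rewrite mem_iota; lia|congr pair; [lia|rewrite !inE; lia]].
Qed.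

(** Locating the run around the position 0 costs (M + 1) rho, and completing each of at most M^2
    runs to a block costs rho; M + 1 + M^2 <= (M + 1)^2. *)
Lemma scan_block (blk : nat -> nat -> nat -> seq (int * bool)) :
  (forall l m, normc (F (run (- m%:Z) l) - \sum_(0 <= r < M) F (blk l m r)) <= rho) ->
  normc (F [::] - \sum_(0 <= l < M) \sum_(0 <= m < l.+1) \sum_(0 <= r < M)
    F (blk l m r)) <= (M.+1 ^ 2)%:R * rho.
Proof.
move=> h; have rho0 : 0 <= rho by apply: le_trans (normc_ge0 _) (h 0%N 0%N).
pose S1 := \sum_(0 <= l < M) \sum_(0 <= m < l.+1) F (run (- m%:Z) l).
have -> : F [::] - \sum_(0 <= l < M) \sum_(0 <= m < l.+1) \sum_(0 <= r < M)
    F (blk l m r) = (F [::] - S1) + \sum_(0 <= l < M) \sum_(0 <= m < l.+1)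
    (F (run (- m%:Z) l) - \sum_(0 <= r < M) F (blk l m r)).
  under [in RHS]eq_bigr do rewrite sumrB.
  by rewrite sumrB addrA subrK.
apply: (le_trans (le_normcD _ _)).
apply: (@le_trans _ _ (M.+1%:R * rho + M%:R * (M%:R * rho))).
  apply: lerD; first exact: scan_run.
  apply: (@le_trans _ _ (\sum_(0 <= l < M) M%:R * rho)); last first.
    by rewrite sumr_const_nat subn0 -[leLHS]mulr_natl.
  apply: normc_sum_le => l; rewrite mem_index_iota => /andP[_ lM] _.
  apply: (@le_trans _ _ (\sum_(0 <= m < l.+1) rho)).
    by apply: normc_sum_le => m _ _; exact: h.
  by rewrite sumr_const_nat subn0 -[leLHS]mulr_natl ler_wpM2r // ler_nat.
rewrite mulrA -mulrDl ler_wpM2r // -natrM -natrD ler_nat; lia.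
Qed.

(** The run around the position 0 is taken as the first run of a block, and the second is found to
    its right. *)
Lemma scan_block_right : normc (F [::] - \sum_(0 <= l < M) \sum_(0 <= m < l.+1)
    \sum_(0 <= r < M) F (block (- m%:Z) l r)) <= (M.+1 ^ 2)%:R * rho.
Proof.
refine (@scan_block (fun l m r => block (- m%:Z) l r) _) => l m.
have := scan_right (run (- m%:Z) l) (- m%:Z + l.+1%:Z + 1).
congr (normc (_ - _) <= _); apply: eq_bigr => r _; apply: F_mem => -[j b].
rewrite mem_block /run !inE mem_cat !inE !mem_ones_right !xpair_eqE.
by case: b => /=; lia.
Qed.

(** The run around the position 0 is now the second run of the block. Its first run, of length r,
    lies to the left of the zero at -m, so the block opens at -m - (r + 1). *)
Lemma scan_block_left : normc (F [::] - \sum_(0 <= l < M) \sum_(0 <= m < l.+1)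
    \sum_(0 <= r < M) F (block (- (m + r.+1)%:Z) r l)) <= (M.+1 ^ 2)%:R * rho.
Proof.
refine (@scan_block (fun l m r => block (- (m + r.+1)%:Z) r l) _) => l m.
have := scan_left (run (- m%:Z) l) (- m%:Z - 1).
congr (normc (_ - _) <= _); apply: eq_bigr => r _; apply: F_mem => -[j b].
rewrite mem_block /run !inE mem_cat !inE mem_ones_right mem_ones_left !xpair_eqE.
by case: b => /=; lia.
Qed.

End Scanning.

Section LinearCombinations.
Variables (R : realType) (G : groupType).

Lemma l2ker_lincomb m n (T : 'M[{malg int[G]}]_(m, n)) (J : Type) (r : seq J)
    (c : J -> R[i]) (v : J -> vec R G n) :
  (forall j, l2ker T (v j)) -> l2ker T (fun i g => \sum_(j <- r) c j * v j i g).
Proof.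
move=> h; split=> [|i g].
  by apply/l2P => i; apply: sqsum_sum => j _; apply: sqsumZ; case: (h j) => /l2P.
have -> : mxact T (fun i g => \sum_(j <- r) c j * v j i g) i g =
    \sum_(j <- r) c j * mxact T (v j) i g.
  rewrite /mxact; under [RHS]eq_bigr do rewrite mulr_sumr.
  rewrite exchange_big; apply: eq_bigr => k _; rewrite /gract.
  under [RHS]eq_bigr do rewrite mulr_sumr.
  rewrite exchange_big; apply: eq_bigr => x _; rewrite -mulrzr mulr_suml.
  by apply: eq_bigr => j _; rewrite -mulrA mulrzr.
by rewrite big1 // => j _; rewrite (h j).2 mulr0.
Qed.

Lemma inner_lincomb n (J : Type) (r : seq J) (c : J -> R[i]) (v : J -> vec R G n)
    (z : vec R G n) : (forall j, l2 (v j)) -> l2 z ->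
  inner (fun i g => \sum_(j <- r) c j * v j i g) z =
  \sum_(j <- r) c j * inner (v j) z.
Proof.
move=> h /l2P z2; rewrite innerE; under [RHS]eq_bigr do rewrite innerE mulr_sumr.
rewrite exchange_big; apply: eq_bigr => i _.
have h2 j : sqsum (v j i) by exact: (l2P _).1 (h j) i.
rewrite ip_suml // => [|j _]; last exact: sqsumZ.
by apply: eq_bigr => j _; rewrite ipZl.
Qed.

Lemma innerC n (u v : vec R G n) : l2 u -> l2 v -> inner v u = (inner u v)^*.
Proof.
move=> /l2P hu /l2P hv; rewrite !innerE rmorph_sum.
by apply: eq_bigr => i _; exact: ipC.
Qed.

End LinearCombinations.

(** * Kernel vectors carried by a word *)

Section Patterns.
Variables (R : realType) (A : finZmodType).
Notation G := (wreathZ A).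

Lemma word_trans n w (f : G -> R[i]) :
  ltr (trans A n) (word w f) = word [seq (l.1 + n, l.2) | l <- w] (ltr (trans A n) f).
Proof. by elim: w => //= -[j b] w IH; rewrite letter_trans IH. Qed.

Lemma word_block a b (off : nat) (f : G -> R[i]) :
  word (block (- off%:Z) a b) f 1%g =
  word (block 0 a b) (ltr (trans A off) f) (trans A off).
Proof.
have -> : block (- off%:Z) a b = [seq (l.1 + (- off%:Z), l.2) | l <- block 0 a b].
  rewrite /block -map_comp; apply: eq_map => k /=.
  by congr pair; rewrite add0r addrC.
have {1}-> : f = ltr (trans A (- off%:Z)) (ltr (trans A off) f).
  by rewrite ltrM transD addNr trans0 ltr1.
by rewrite -word_trans {1}/ltr transV opprK mulg1.
Qed.

Lemma dl_rtr (h : G) : dl R h = rtr h^-1%g (dl R 1%g).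
Proof.
by apply/funext => x; rewrite /dl /rtr -(inj_eq (mulIg h^-1%g)) mulgV.
Qed.

Lemma word_dl_trans w (j n m : int) : j \notin map fst w -> uniq (map fst w) ->
  word w (dl R (trans A n)) (trans A m) = (m == n)%:R * (prob R A w)%:C.
Proof.
move=> jw uw; rewrite dl_rtr word_rtr /rtr transV transD.
have [->|mn] := eqVneq m n; first by rewrite subrr trans0 word_dl // mul1r.
rewrite mul0r; apply: (word_dl_support R jw); left.
by rewrite /= subr_eq0.
Qed.

(** The entry at the identity is an inner product with the indicator of 1, which the M ones project
    to a vector of squared norm (1 - 1/#|A|)^M; Cauchy-Schwarz gives the bound. *)
Lemma normc_word_small w s M (f : G -> R[i]) : sqsum f ->
  (forall k, (k < M)%N -> (s + k%:Z, true) \in w) ->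
  normc (word w f 1%g) ^+ 2 <= (1 - #|A|%:R^-1) ^+ M * nsq f.
Proof.
move=> f2 hw; pose u := ones (fun k => s + k%:Z) M.
have uw : {subset u <= w} by move=> x /mem_ones[k kM ->]; exact: hw.
have uu : uniq (map fst u).
  by rewrite -map_comp map_inj_uniq ?iota_uniq // => k l /= /addrI [].
have wf2 := sqsum_word w f2; have d2 := sqsum_dl R (1%g : G).
have ud2 := sqsum_word u d2.
rewrite -(word_sub f uw) -[X in normc X]ip_dl ip_word //.
apply: (le_trans (cauchy_schwarz wf2 ud2)); rewrite mulrC.
have -> : nsq (word u (dl R (1%g : G))) = (1 - #|A|%:R^-1) ^+ M.
  rewrite /nsq ip_word // (_ : word u (word u _) = word u (dl R 1%g)).
    rewrite -ip_word // ip_dl word_dl //= /prob big_map big_const_seq count_predT size_iota.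
    by rewrite iter_mulr_1.
  by apply: word_sub.
rewrite ler_wpM2l ?nsq_word // exprn_ge0 // subr_ge0 invf_le1 ?ler1n ?ltr0n;
  by apply/card_gt0P; exists 0.
Qed.

(** The vector that follows the profile [kap] along the word [w]: [eta] is its free parameter, and
    translation by -o places the origin at offset [o] of the word, where component [i] has the
    coefficient [kap i o]. *)
Definition pattern n (kap : 'I_n -> nat -> int) e w (eta : G -> R[i]) : vec R G n :=
  fun i x => \sum_(0 <= o < e) (kap i o)%:~R * ltr (trans A (- o%:Z)) (word w eta) x.

Lemma l2_pattern n (kap : 'I_n -> nat -> int) e w (eta : G -> R[i]) :
  sqsum eta -> l2 (pattern kap e w eta).
Proof.
move=> h; apply/l2P => i; apply: sqsum_sum => o _; apply: sqsumZ; apply: sqsum_ltr.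
exact: sqsum_word.
Qed.

(** At each offset either the word carries the letter opposite to the tested one, and the rule is
    vacuous, or the coefficients satisfy the recurrence. The offset e, where the profile is already
    0, counts as well because a rule looks one step back. *)
Lemma pattern_ker m n (r : 'I_m -> rule n) (kap : 'I_n -> nat -> int) e w (eta : G -> R[i]) :
  sqsum eta -> (forall i, kap i e = 0) ->
  (forall k o, (o <= e)%N -> (rpos (r k) + o%:Z, ~~ rbit (r k)) \in w \/
     \sum_i rnow (r k) i * kap i o +
     \sum_i rprev (r k) i * (if o is o'.+1 then kap i o' else 0) = 0) ->
  l2ker (rule_mx A r) (pattern kap e w eta).
Proof.
move=> h kape hr; apply/l2ker_rule; split=> [|k]; first exact: l2_pattern.
pose c (o : nat) : int := \sum_i rnow (r k) i * kap i o +
     \sum_i rprev (r k) i * (if o is o'.+1 then kap i o' else 0).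
have -> : rule_sum (r k) 0 (pattern kap e w eta) =
    fun x => \sum_(0 <= o < e.+1) (c o)%:~R * ltr (trans A (- o%:Z)) (word w eta) x.
  apply/funext => x; rewrite /rule_sum trans0 sub0r.
  under [RHS]eq_bigr do rewrite /c rmorphD mulrDl !rmorph_sum !mulr_suml.
  rewrite big_split /=; congr (_ + _).
    rewrite exchange_big; apply: eq_bigr => i _; rewrite ltr1 mulr_sumr.
    rewrite big_nat_recr //= kape mulr0 mul0r addr0.
    by apply: eq_bigr => o _; rewrite rmorphM mulrA.
  rewrite exchange_big; apply: eq_bigr => i _.
  rewrite big_nat_recl //= mulr0 mul0r add0r /ltr /pattern mulr_sumr.
  apply: eq_bigr => o _; rewrite rmorphM mulrA /ltr; congr (_ * word w eta _).
  by rewrite mulgA -invgM transD; congr ((trans A _)^-1 * _)%g; lia.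
apply/funext => x; rewrite letter_sum big_nat big1 // => o /andP[_ oe].
have [kill|c0] := hr k o oe; last by rewrite [c o]c0 mulr0z mul0r.
have -> : rpos (r k) = rpos (r k) + o%:Z + (- o%:Z) by rewrite addrK.
by rewrite -letter_trans letter_word0 // /ltr mulr0.
Qed.

Lemma inner_pattern n (kap : 'I_n -> nat -> int) e w h (z : vec R G n) : l2 z ->
  inner (pattern kap e w (dl R h)) z =
  \sum_i \sum_(0 <= o < e) (kap i o)%:~R * (word w (ltr (trans A o) (z i)) h)^*.
Proof.
move=> /l2P z2; rewrite innerE; apply: eq_bigr => i _.
have d2 := sqsum_dl R h; have hw o : sqsum (ltr (trans A o) (word w (dl R h))).
  by apply: sqsum_ltr; exact: sqsum_word.
rewrite ip_suml // => [|o _]; last exact: sqsumZ.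
apply: eq_bigr => o _; rewrite ipZl // ip_ltr //; last exact: sqsum_word.
rewrite transV opprK ip_word //; last exact: sqsum_ltr.
have zw := sqsum_word w (sqsum_ltr (trans A o) (z2 i)).
by rewrite (ipC zw d2) ip_dl.
Qed.

Lemma pattern_dl n (kap : 'I_n -> nat -> int) e w j i (off : nat) :
  j \notin map fst w -> uniq (map fst w) -> (off < e)%N ->
  pattern kap e w (dl R (trans A off)) i 1%g = (kap i off)%:~R * (prob R A w)%:C.
Proof.
move=> jw uw oe; rewrite /pattern /ltr (bigD1_seq off) ?iota_uniq ?mem_index_iota //=.
rewrite big1 ?addr0 => [|o oo]; rewrite transV opprK mulg1 (word_dl_trans _ _ jw uw).
  by rewrite eqxx mul1r.
by rewrite eqz_nat (negPf oo) mul0r mulr0.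
Qed.

Lemma uniq_block c a b : uniq (map fst (block c a b)).
Proof. by rewrite -map_comp map_inj_uniq ?iota_uniq // => k l /= /addrI []. Qed.

Lemma notin_block a b : -1 \notin map fst (block 0 a b).
Proof. by apply/negP => /mapP[[j i]]; rewrite mem_block /=; lia. Qed.

Lemma prob_block c a b :
  prob R A (block c a b) = #|A|%:R^-1 ^+ 3 * (1 - #|A|%:R^-1) ^+ (a + b).
Proof.
rewrite [LHS]big_map.
have -> : (a + b).+3 = (1 + (a + (1 + (b + 1))))%N by lia.
rewrite !iotaD !big_cat /= !big_cons !big_nil !inE.
have e n m : (forall k, (n <= k < n + m)%N -> (k \notin [:: 0; a.+1; (a + b).+2])%N) ->
    \prod_(k <- iota n m) (if (k \notin [:: 0; a.+1; (a + b).+2])%N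
      then 1 - #|A|%:R^-1 else #|A|%:R^-1) = (1 - #|A|%:R^-1) ^+ m :> R.
  move=> h; rewrite big_seq (eq_bigr (fun=> 1 - #|A|%:R^-1)) => [|k]; last first.
    by rewrite mem_iota => /h ->.
  by rewrite -big_seq big_const_seq count_predT size_iota iter_mulr_1.
rewrite !e; try by move=> k; rewrite !inE; lia.
rewrite !ifF; try by lia.
by rewrite exprD /=; ring.
Qed.

End Patterns.

(** * The doubling system *)

Definition mk_rule b (now prev : seq int) : rule 4 :=
  @Rule 4 0 b (fun i => now`_i) (fun i => prev`_i).

(* The components P, Q, Y, Z have the indices 0, 1, 2, 3. Along the first run  *)
(* of ones P doubles and Q is constant; at the zero that begins the run they  *)
(* are equal, and at the zero that ends it Y and Z take over their values.    *)
(* Along the second run Y is constant and Z decreases by Y at each step, down *)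
(* to 0 just before the closing zero.                                         *)
Definition doubling_rule (k : 'I_8) : rule 4 :=
  nth (mk_rule false [::] [::])
    [:: mk_rule true [:: 1] [:: -2]; mk_rule true [:: 0; 1] [:: 0; -1];
        mk_rule true [:: 0; 0; 1] [:: 0; 0; -1];
        mk_rule true [:: 0; 0; 0; 1] [:: 0; 0; 1; -1];
        mk_rule false [:: 1; -1] [::]; mk_rule false [:: 0; 0; 1] [:: 0; -1];
        mk_rule false [:: 0; 0; 0; 1] [:: -1];
        mk_rule false [::] [:: 0; 0; 0; 1] ] k.

(* The values of P, Q, Y, Z at distance o from the zero that opens the word   *)
(* 0 1^a 0 1^b 0, when P and Q start from 1.                                  *)
Definition kappa (a b : nat) (i : 'I_4) (o : nat) : int :=
  [:: if (o <= a)%N then 2 ^+ o else 0;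
      if (o <= a)%N then 1 else 0;
      if (a < o <= (a + b).+1)%N then 1 else 0;
      if (a < o <= (a + b).+1)%N then 2 ^+ a - (o - a.+1)%N%:Z else 0]`_i.

(** Blocks overlap: the second run of one is the first run of the next. For P and Q a position is
    charged to the block that begins with its run, for Y and Z to the block that ends with it; these
    are the offsets that count for component [i]. *)
Definition role (a b : nat) (i : 'I_4) (o : nat) :=
  if (i < 2)%N then (o <= a)%N else (a < o <= (a + b).+1)%N.

Local Notation iP := (ord0 : 'I_4).
Local Notation iQ := (lift ord0 ord0 : 'I_4).
Local Notation iY := (lift ord0 (lift ord0 ord0) : 'I_4).
Local Notation iZ := (lift ord0 (lift ord0 (lift ord0 ord0)) : 'I_4).

Lemma ord4_ind (Q : 'I_4 -> Prop) : Q iP -> Q iQ -> Q iY -> Q iZ -> forall i, Q i.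
Proof.
move=> h0 h1 h2 h3 [[|[|[|[|//]]]] hi].
- by rewrite (_ : Ordinal _ = iP) //; apply: val_inj.
- by rewrite (_ : Ordinal _ = iQ) //; apply: val_inj.
- by rewrite (_ : Ordinal _ = iY) //; apply: val_inj.
- by rewrite (_ : Ordinal _ = iZ) //; apply: val_inj.
Qed.

Section DoublingKernel.
Variables (R : realType) (A : finZmodType).
Notation G := (wreathZ A).
Notation K := (l2ker (rule_mx A doubling_rule)).

Lemma kappa0 a b i o : ~~ role a b i o -> kappa a b i o = 0.
Proof.
by elim/ord4_ind: i; rewrite /role /kappa /= => /negPf ->.
Qed.

Section Relations.
Variables (z : vec R G 4) (w : seq (int * bool)) (x : G).
Hypothesis zK : K z.
Let W i (o : int) := word w (ltr (trans A o) (z i)) x.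

Lemma rel_true (s : int) : (s, true) \in w ->
  [/\ W iP s = 2 * W iP (s - 1), W iQ s = W iQ (s - 1),
      W iY s = W iY (s - 1) & W iZ s = W iZ (s - 1) - W iY (s - 1)].
Proof.
rewrite -[s in (s, _)]add0r => sw.
have h k := @word_rule R A 8 4 doubling_rule z k s w x zK.
have := h ord0 sw; have := h (@Ordinal 8 1 isT) sw.
have := h (@Ordinal 8 2 isT) sw; have := h (@Ordinal 8 3 isT) sw.
rewrite !big_ord_recl !big_ord0 /= => h3 h2 h1 h0.
rewrite /W; split; apply/eqP; rewrite -subr_eq0; apply/eqP.
- by rewrite -[RHS]h0; ring.
- by rewrite -[RHS]h1; ring.
- by rewrite -[RHS]h2; ring.
- by rewrite -[RHS]h3; ring.
Qed.

Lemma rel_false (s : int) : (s, false) \in w ->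
  [/\ W iP s = W iQ s, W iY s = W iQ (s - 1), W iZ s = W iP (s - 1) &
      W iZ (s - 1) = 0].
Proof.
rewrite -[s in (s, _)]add0r => sw.
have h k := @word_rule R A 8 4 doubling_rule z k s w x zK.
have := h (@Ordinal 8 4 isT) sw; have := h (@Ordinal 8 5 isT) sw.
have := h (@Ordinal 8 6 isT) sw; have := h (@Ordinal 8 7 isT) sw.
rewrite !big_ord_recl !big_ord0 /= => h3 h2 h1 h0.
rewrite /W; split; apply/eqP; rewrite -subr_eq0; apply/eqP.
- by rewrite -[RHS]h0; ring.
- by rewrite -[RHS]h1; ring.
- by rewrite -[RHS]h2; ring.
- by rewrite -[RHS]h3; ring.
Qed.

End Relations.

(** Everything is a multiple of the value v of P at the opening zero. Z enters the second run at 2^a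
    v and stands at (2^a - b) v just before the closing zero, where it must vanish; so v is free
    only if b = 2^a. *)
Lemma doubling_recursion a b (W : 'I_4 -> nat -> R[i]) :
  (forall o, o.+1 != a.+1 -> (o < (a + b).+1)%N ->
    [/\ W iP o.+1 = 2 * W iP o, W iQ o.+1 = W iQ o,
      W iY o.+1 = W iY o & W iZ o.+1 = W iZ o - W iY o]) ->
  W iP 0%N = W iQ 0%N -> W iY a.+1 = W iQ a -> W iZ a.+1 = W iP a ->
  W iZ (a + b).+1 = 0 ->
  (2 ^+ a - b%:R) * W iP 0%N = 0 /\
  forall i o, role a b i o -> W i o = (kappa a b i o)%:~R * W iP 0%N.
Proof.
move=> rt Q0 Yd Zd Ze; set v := W iP 0%N in Q0 *.
have hPQ o : (o <= a)%N -> W iP o = 2 ^+ o * v /\ W iQ o = v.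
  elim: o => [|o IH] oa; first by rewrite expr0 mul1r -Q0.
  have [| |-> -> _ _] := rt o; [lia|lia|].
  by have [-> ->] := IH (ltnW oa); rewrite exprS mulrA.
have [hPa hQa] := hPQ a (leqnn a).
have hYZ o : (o <= b)%N -> W iY (a.+1 + o)%N = v /\ W iZ (a.+1 + o)%N = (2 ^+ a - o%:R) * v.
  elim: o => [|o IH] ob; first by rewrite addn0 Yd Zd hPa hQa subr0.
  rewrite addnS; have [| |_ _ -> ->] := rt (a.+1 + o)%N; [lia|lia|].
  by have [-> ->] := IH (ltnW ob); split => //; rewrite -natr1; ring.
split; first by rewrite -(hYZ b (leqnn b)).2.
elim/ord4_ind => o; rewrite /role /= => ho; rewrite /kappa /= ho.
- by rewrite (hPQ _ ho).1 rmorphXn.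
- by rewrite (hPQ _ ho).2 mul1r.
- have -> : o = (a.+1 + (o - a.+1))%N by lia.
  by rewrite (hYZ _ _).1 ?mul1r //; lia.
- have {1}-> : o = (a.+1 + (o - a.+1))%N by lia.
  by rewrite (hYZ _ _).2 ?rmorphB ?rmorphXn //; lia.
Qed.

Lemma block_rel (z : vec R G 4) a b x : K z ->
  let W i (o : nat) := word (block 0 a b) (ltr (trans A o) (z i)) x in
  (2 ^+ a - b%:R) * W iP 0%N = 0 /\
  forall i o, role a b i o -> W i o = (kappa a b i o)%:~R * W iP 0%N.
Proof.
move=> zK W; have pred1 (o : nat) : o.+1%:Z - 1 = o by lia.
have rf (o : nat) : ((o.+1)%:Z, false) \in block 0 a b ->
  [/\ W iP o.+1 = W iQ o.+1, W iY o.+1 = W iQ o, W iZ o.+1 = W iP o & W iZ o = 0].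
  by move=> /(rel_false x zK); rewrite pred1.
have [|_ Yd Zd _] := rf a; first by rewrite mem_block; lia.
have [|_ _ _ Ze] := rf (a + b).+1; first by rewrite mem_block; lia.
have [|Q0 _ _ _] := @rel_false z (block 0 a b) x zK 0; first by rewrite mem_block; lia.
apply: (@doubling_recursion a b W _ Q0 Yd Zd Ze) => o oa oe.
have [|] := @rel_true z (block 0 a b) x zK o.+1; first by rewrite mem_block; lia.
by rewrite pred1; split.
Qed.

Lemma block_pattern_ker a (eta : G -> R[i]) : sqsum eta ->
  K (pattern (kappa a (2 ^ a)) (a + 2 ^ a).+2 (block 0 a (2 ^ a)) eta).
Proof.
move=> h; apply: pattern_ker => // [i|k o oe].
  by apply: kappa0; elim/ord4_ind: i; rewrite /role /=; lia.
have pw n : 2 ^+ n = (2 ^ n)%N%:Z by elim: n => // n IH; rewrite exprS IH expnS PoszM.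
(* At the three zeros the four rules that test for a one are vacuous, elsewhere the four that test
   for a zero; the rest are identities between values of [kappa]. *)
have [ho|ho] := boolP [|| o == 0, o == a.+1 | o == (a + 2 ^ a).+2]%N.
{ have mo : (0 + o%:Z, false) \in block 0 a (2 ^ a) by rewrite mem_block; lia.
  case: k => [[|[|[|[|[|[|[|[|//]]]]]]]] hk]; first [by left | right];
    rewrite /doubling_rule /= !big_ord_recl !big_ord0 /kappa ?add0n /= ?add0n /= ?pw.
  all: clear mo; case/or3P: ho => /eqP -> /=; repeat case: ifP => ? /=; rewrite ?pw; lia. }
have mo : (0 + o%:Z, true) \in block 0 a (2 ^ a) by rewrite mem_block; lia.
case: o oe ho mo => [|o] oe ho mo; first by [].
case: k => [[|[|[|[|[|[|[|[|//]]]]]]]] hk]; first [by left | right];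
  rewrite /doubling_rule /= !big_ord_recl !big_ord0 /kappa ?add0n /= ?add0n /= ?pw.
all: clear mo; repeat case: ifP => ? /=; rewrite ?pw ?expnS; lia.
Qed.

End DoublingKernel.

Lemma poly_geometric_cvg0 (R : realType) (x : R) : 0 <= x < 1 ->
  (((2 ^ n).+1 ^ 2)%:R * Num.sqrt (x ^+ (2 ^ n))) @[n --> \oo] --> 0.
Proof.
(* [v] is the eighth root of x, so that the square root of x^M is v^(4M). Since (M + 1) v^M is at
   most the geometric sum 1/(1 - v), half of this power absorbs (M + 1)^2 and the other half tends
   to 0. *)
move=> /andP[x0 x1]; pose v := Num.sqrt (Num.sqrt (Num.sqrt x)).
have v0 : 0 <= v by exact: sqrtr_ge0.
have s1 (y : R) : y < 1 -> Num.sqrt y < 1.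
  by move=> y1; rewrite -sqrtr1 ltr_sqrt.
have v1 : v < 1 by rewrite !s1.
have vE : Num.sqrt x = v ^+ 4.
  by rewrite (exprM v 2 2) !sqr_sqrtr ?sqrtr_ge0.
have bnd M : M.+1%:R * v ^+ M <= (1 - v)^-1.
  rewrite -[leRHS]mul1r; have [->|vn0] := eqVneq v 0.
    by case: M => [|M]; rewrite ?expr0 ?subr0 ?invr1 ?mulr1 // exprS mul0r mulr0.
  have vp : 0 < v by rewrite lt_neqAle eq_sym vn0.
  apply: (@le_trans _ _ (series (geometric 1 v) M.+1)).
    rewrite /series /= big_mkord mulr_natl -[X in _ *+ X]card_ord -sumr_const.
    apply: ler_sum => k _; rewrite /= mul1r; apply: ler_wiXn2l => //; first exact: ltW.
    by rewrite -ltnS.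
  by apply: geometric_le_lim => //; rewrite ger0_norm.
apply: (@squeeze_cvgr _ _ _ _ (fun=> 0) (fun n => (1 - v)^-1 ^+ 2 * (v ^+ 2) ^+ n)).
- near=> n; rewrite mulr_ge0 ?ler0n ?sqrtr_ge0 //=.
  have -> : Num.sqrt (x ^+ (2 ^ n)) = Num.sqrt x ^+ (2 ^ n).
    rewrite -[in LHS](sqr_sqrtr x0) -exprM mulnC exprM sqrtr_sqr.
    by rewrite ger0_norm ?exprn_ge0 ?sqrtr_ge0.
  rewrite vE natrX -exprM.
  have -> : (v ^+ (4 * 2 ^ n) : R) = (v ^+ (2 ^ n)) ^+ 2 * (v ^+ 2) ^+ (2 ^ n).
    by rewrite -!exprM -exprD; congr (_ ^+ _); lia.
  rewrite mulrA -exprMn; apply: ler_pM; rewrite ?exprn_ge0 ?mulr_ge0 ?exprn_ge0 //.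
    by rewrite ler_sqr ?nnegrE ?mulr_ge0 ?exprn_ge0 ?invr_ge0 ?subr_ge0 ?(ltW v1) ?bnd.
  apply: ler_wiXn2l; rewrite ?exprn_ge0 ?exprn_ile1 ?(ltW v1) //.
  by apply: ltnW; exact: ltn_expl.
- exact: cvg_cst.
- apply: cvg_geometric; rewrite ger0_norm ?exprn_ge0 //.
  by rewrite expr_lt1.
Unshelve. all: by end_near. Qed.

(** * The projection onto the kernel of the doubling system *)

Section MainKernel.
Variables (R : realType) (A : finZmodType).
Notation G := (wreathZ A).
Notation K := (l2ker (rule_mx A doubling_rule)).
Notation kap a := (kappa a (2 ^ a)).
Notation len a := ((a + 2 ^ a).+2).
Notation blk a := (block 0 a (2 ^ a)).
Implicit Types (z : vec R G 4) (a L : nat).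

Definition weight a : int := \sum_i \sum_(0 <= o < len a) kap a i o ^+ 2.

Lemma weight_gt0 a : 0 < weight a.
Proof.
rewrite /weight (bigD1 iP) //= big_nat_recl //= -addrA ltr_wpDr //.
by rewrite addr_ge0 // sumr_ge0 // => *; rewrite ?sumr_ge0 // => *; rewrite sqr_ge0.
Qed.

(** The part of the projection of [zeta i] that belongs to the block with first run a. Pairing one
    of these patterns with a kernel vector gives [weight a] times a conjugated amplitude, whence the
    division; [kap a i o] is the coefficient of component [i] when the origin has offset [o]. *)
Definition approx1 a i : vec R G 4 := fun i' x =>
  \sum_(0 <= o < len a) (kap a i o)%:~R / (weight a)%:~R *
    pattern (kap a) (len a) (blk a) (dl R (trans A o)) i' x.

Definition approx L i : vec R G 4 := fun i' x =>
  \sum_(0 <= a < L) 1 * approx1 a i i' x.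

Lemma approx1_ker a i : K (approx1 a i).
Proof.
by apply: l2ker_lincomb => o; apply: block_pattern_ker; exact: sqsum_dl.
Qed.

Lemma approx_ker L i : K (approx L i).
Proof. by apply: l2ker_lincomb => a; exact: approx1_ker. Qed.

(** The free parameter of [z] on a block, namely the value of P at the opening zero, for the block
    in which the origin has offset [o]. *)
Definition amplitude z a (o : nat) : R[i] :=
  word (blk a) (ltr (trans A 0) (z iP)) (trans A o).

Lemma inner_approx L i z : K z -> inner (approx L i) z =
  (\sum_(0 <= a < L) \sum_(0 <= o < len a) (kap a i o)%:~R * amplitude z a o)^*.
Proof.
move=> zK; have [z2 _] := zK.
rewrite inner_lincomb // => [|a]; last by case: (approx1_ker a i).
rewrite [RHS]rmorph_sum /=; apply: eq_bigr => a _; rewrite mul1r.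
rewrite inner_lincomb // => [|o]; last by apply: l2_pattern; exact: sqsum_dl.
rewrite [RHS]rmorph_sum /=; apply: eq_bigr => o _. rewrite inner_pattern //.
have -> : \sum_i0 \sum_(0 <= o0 < len a) (kap a i0 o0)%:~R *
    (word (blk a) (ltr (trans A o0) (z i0)) (trans A o))^* =
    (weight a)%:~R * (amplitude z a o)^*.
  rewrite /weight rmorph_sum mulr_suml; apply: eq_bigr => i' _.
  rewrite rmorph_sum mulr_suml; apply: eq_bigr => o' _.
  have [r|nr] := boolP (role a (2 ^ a) i' o').
    have [_ h] := block_rel a (2 ^ a) (trans A o) zK.
    by rewrite h // [in LHS]rmorphM /= rmorph_int mulrA [in RHS]rmorphXn /= expr2.
  by rewrite (kappa0 nr) expr0n mulr0z !mul0r.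
have w0 : ((weight a)%:~R : R[i]) != 0 by rewrite intr_eq0 gt_eqF // weight_gt0.
by rewrite mulrA divfK // [RHS]rmorphM /= rmorph_int.
Qed.

Lemma block_amplitude z a b i o : K z -> role a b i o ->
  word (block (- o%:Z) a b) (z i) 1%g =
  if b == (2 ^ a)%N then (kap a i o)%:~R * amplitude z a o else 0.
Proof.
move=> zK r; rewrite word_block; have [h0 h] := block_rel a b (trans A o) zK.
rewrite h //; case: eqP => [->//|/eqP nb].
move/eqP: h0; rewrite mulf_eq0 subr_eq0 -natrX eqr_nat eq_sym (negPf nb) /=.
by move=> /eqP ->; rewrite mulr0.
Qed.

Lemma scan_value L i z : K z ->
  normc (z i 1%g - \sum_(0 <= a < L) \sum_(0 <= o < len a)
    (kap a i o)%:~R * amplitude z a o) <=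
  (((2 ^ L).+1 ^ 2)%:R * Num.sqrt ((1 - #|A|%:R^-1) ^+ (2 ^ L) * nsq (z i))).
Proof.
move=> zK; have [/l2P z2 _] := zK; set rho := Num.sqrt _.
pose F w := word w (z i) 1%g.
have F_split j w : F w = F ((j, false) :: w) + F ((j, true) :: w).
  exact: letter_split.
have F_mem w1 w2 : w1 =i w2 -> F w1 = F w2 by move=> e; rewrite /F (eq_word _ e).
have F_small w s : (forall k, (k < 2 ^ L)%N -> (s + k%:Z, true) \in w) ->
    normc (F w) <= rho.
  by move=> h; apply: normc_le_sqrt; apply: normc_word_small h.
(* Runs are cut at M = 2^L so that 2^a < M is equivalent to a < L: the blocks with b = 2^a that
   survive the cut are exactly those used in [approx]. *)
have lM l : (2 ^ l < 2 ^ L)%N = (l < L)%N by rewrite ltn_exp2l.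
have ltM l : (l < L)%N -> (l < 2 ^ L)%N.
  by move=> h; apply: (leq_trans h); apply: ltnW; exact: ltn_expl.
have LM : (L <= 2 ^ L)%N by apply: ltnW; exact: ltn_expl.
have restrict (f : nat -> R[i]) : \sum_(0 <= l < 2 ^ L) (if (2 ^ l < 2 ^ L)%N then f l else 0)
    = \sum_(0 <= l < L) f l.
  by rewrite -big_mkcond (big_nat_widen 0 L (2 ^ L)) //; apply: eq_bigl => l; rewrite lM.
(* P and Q are expanded over the blocks that begin with the run at the origin, Y and Z over those
   that end with it, in accordance with [role]. *)
have [i2|i2] := ltnP i 2.
  have := scan_block_right F_split F_mem F_small.
  congr (normc (_ - _) <= _); rewrite -restrict; apply: eq_big_nat => l lL.
  have e m : (m < l.+1)%N -> \sum_(0 <= r < 2 ^ L) F (block (- m%:Z) l r) =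
      if (2 ^ l < 2 ^ L)%N then (kap l i m)%:~R * amplitude z l m else 0.
    move=> ml; under eq_bigr do rewrite /F block_amplitude ?/role ?i2 //.
    by rewrite -big_mkcond big_nat1_eq.
  rewrite (eq_big_nat _ _ (F2 := fun m => if (2 ^ l < 2 ^ L)%N then
     (kap l i m)%:~R * amplitude z l m else 0)) => [|m ml]; last exact: e.
  case: ifP => _; last by rewrite big1.
  rewrite [RHS](@big_cat_nat _ _ _ l.+1) //=; last by lia.
  rewrite [X in _ = _ + X]big_nat [X in _ = _ + X]big1 ?addr0 // => m lm.
  by rewrite kappa0 ?mul0r // /role i2; lia.
have := scan_block_left F_split F_mem F_small.
congr (normc (_ - _) <= _); rewrite -restrict.
have e l m r : (m < l.+1)%N -> F (block (- (m + r.+1)%:Z) r l) =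
    if l == (2 ^ r)%N then (kap r i (m + r.+1))%:~R * amplitude z r (m + r.+1) else 0.
  by move=> ml; rewrite /F block_amplitude // /role ltnNge i2 /=; lia.
transitivity (\sum_(0 <= r < 2 ^ L) \sum_(0 <= l < 2 ^ L) if l == (2 ^ r)%N then
   \sum_(0 <= m < l.+1) (kap r i (m + r.+1))%:~R * amplitude z r (m + r.+1) else 0).
  rewrite [RHS]exchange_big; apply: eq_big_nat => l _ /=.
  rewrite exchange_big; apply: eq_big_nat => r _ /=.
  case: ifP => lr; last first.
    by rewrite big_nat big1 // => m /andP[_ ml]; rewrite e // lr.
  by apply: eq_big_nat => m /andP[_ ml]; rewrite e // lr.
apply: eq_big_nat => r _; rewrite -big_mkcond big_nat1_eq leq0n andTb.
case: ifP => // _; rewrite [RHS](@big_cat_nat _ _ _ r.+1) //=; last by lia.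
rewrite [X in _ = X + _]big_nat [X in _ = X + _]big1 ?add0r; last first.
  by move=> m rm; rewrite kappa0 ?mul0r // /role ltnNge i2 /=; lia.
have -> : (2 ^ r).+1 = (len r - r.+1)%N by lia.
by rewrite -(big_addn 0 (len r) r.+1 xpredT (fun o => (kap r i o)%:~R * amplitude z r o)).
Qed.

Definition error L : R :=
  ((2 ^ L).+1 ^ 2)%:R * Num.sqrt ((1 - #|A|%:R^-1) ^+ (2 ^ L)).

Lemma approx_error L i z : K z ->
  normc (inner (vsub (zeta R i) (approx L i)) z) ^+ 2 <= error L ^+ 2 * nsqv z.
Proof.
move=> zK; have [z2 _] := zK; have [a2 _] := approx_ker L i.
have ze2 := l2_zeta R G i.
rewrite innerBl // inner_approx // (innerC z2 ze2) inner_zeta -rmorphB normc_conj.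
have x0 : 0 <= 1 - (#|A|%:R^-1 : R).
  by rewrite subr_ge0 invf_le1 ?ler1n ?ltr0n; apply/card_gt0P; exists 0.
apply: (@le_trans _ _ ((error L * Num.sqrt (nsqv z)) ^+ 2)); last first.
  by rewrite exprMn [X in _ * X]sqr_sqrtr // nsqv_ge0.
have e0 : 0 <= error L by rewrite mulr_ge0 // sqrtr_ge0.
rewrite ler_sqr ?nnegrE ?normc_ge0 ?mulr_ge0 ?sqrtr_ge0 //.
apply: (le_trans (scan_value L i zK)).
rewrite /error -mulrA ler_wpM2l // -sqrtrM ?exprn_ge0 // ler_wsqrtr //.
by rewrite ler_wpM2l ?exprn_ge0 // nsq_le_nsqv.
Qed.

(** Over all components and offsets the squares of the coefficients add up to [weight a] and cancel
    the division, so each block contributes exactly its probability. *)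
Lemma trace_approx L : \sum_i approx L i i 1%g =
  (\sum_(0 <= a < L) #|A|%:R^-1 ^+ 3 * (1 - #|A|%:R^-1) ^+ (a + 2 ^ a))%:C.
Proof.
rewrite exchange_big rmorph_sum /=; apply: eq_bigr => a _.
have w0 : ((weight a)%:~R : R[i]) != 0 by rewrite intr_eq0 gt_eqF // weight_gt0.
rewrite -(prob_block R A 0); set P := (prob _ _ _)%:C; set c := (weight a)%:~R in w0.
have e i : approx1 a i i 1%g = \sum_(0 <= o < len a) (kap a i o ^+ 2)%:~R * (P / c).
  apply: eq_big_nat => o /andP[_ oa].
  rewrite (pattern_dl R A _ i (notin_block a (2 ^ a)) (uniq_block 0 a (2 ^ a)) oa).
  by rewrite rmorphXn /= -/P -/c; ring.
under eq_bigr do rewrite mul1r e -mulr_suml.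
rewrite -mulr_suml mulrCA; under eq_bigr do rewrite -rmorph_sum.
by rewrite -rmorph_sum -/(weight a) -/c mulfV ?mulr1.
Qed.

Lemma is_kerdim_doubling (d : R) :
  (\sum_(0 <= a < L) #|A|%:R^-1 ^+ 3 * (1 - #|A|%:R^-1) ^+ (a + 2 ^ a))
    @[L --> \oo] --> d -> is_kerdim G d.
Proof.
move=> hd; exists 8%N, 4%N, (rule_mx A doubling_rule).
have error0 : error L @[L --> \oo] --> 0.
  apply: poly_geometric_cvg0; rewrite subr_ge0 invf_le1 ?ler1n ?ltr0n ?gtrBl ?invr_gt0 ?ltr0n;
  by [apply/card_gt0P; exists 0|apply/andP; split; apply/card_gt0P; exists 0].
have error_ge0 L : 0 <= error L by rewrite mulr_ge0 // sqrtr_ge0.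
have h i := orth_proj_exists (l2_zeta R G i) (fun L => approx_ker L i) error0
   error_ge0 (fun L z => @approx_error L i z).
exists (fun i => projT1 (cid (h i))); split=> [i|].
  by have [? ? _] := projT2 (cid (h i)).
apply: (@ccvg_unique _ (fun L => \sum_i approx L i i 1%g)).
  by apply: ccvg_sum => i; have [_ _ hy] := projT2 (cid (h i)); exact: hy.
under eq_fun do rewrite trace_approx.
by split => //=; exact: cvg_cst.
Qed.

End MainKernel.

(** * Mahler's method *)

Section FunctionalEquation.
Variables (R : realType) (x : R) (phi : nat -> R).
Hypotheses (x_gt0 : 0 < x) (x_lt1 : x < 1).
Hypothesis phiE : forall n, phi n = x ^+ (2 ^ n) + x * phi n.+1.

Lemma coef_XsubC_exp (S : nzRingType) (c : S) n i :
  (n <= i)%N -> (('X - c%:P) ^+ n)`_i = (i == n)%:R.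
Proof.
move=> ni; have m : ('X - c%:P) ^+ n \is monic by rewrite monic_exp ?monicXsubC.
have [->|ne] := eqVneq i n.
  by have := monicP m; rewrite lead_coefE size_exp_XsubC.
by rewrite nth_default // size_exp_XsubC ltn_neqAle eq_sym ne.
Qed.

Lemma coefpred_XsubC_exp (S : comNzRingType) (c : S) n :
  (('X - c%:P) ^+ n.+1)`_n = - (c *+ n.+1).
Proof.
elim: n => [|n IH]; first by rewrite expr1 coefB coefX coefC /= sub0r.
rewrite exprS mulrBl coefB coefXM /= coefCM IH coef_XsubC_exp // eqxx mulr1.
by rewrite -opprD -mulrSr.
Qed.

(* With A / B in lowest terms this says that r = A / B solves                 *)
(* r(z) = x r(z^2) - d z; then B is constant, and the coefficients of z^(2^k) *)
(* in A are all nonzero.                                                      *)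
Lemma no_rational_solution (A B : {poly R}) d : B != 0 -> (0 < d)%N ->
  B * (x *: (A \Po 'X^2) - d%:R *: ('X * (B \Po 'X^2))) = (B \Po 'X^2) * A -> False.
Proof.
wlog: A B / coprimep A B => [wl|cop] B0 d0.
  pose g := gcdp A B; have g0 : g != 0 by rewrite gcdp_eq0 negb_and B0 orbT.
  have [EA EB] : A = (A %/ g) * g /\ B = (B %/ g) * g.
    by rewrite !divpK ?dvdp_gcdl ?dvdp_gcdr.
  have g20 : g \Po 'X^2 != 0.
    by rewrite comp_poly_eq0 // size_polyXn.
  move=> h; apply: (wl (A %/ g) (B %/ g)) => //.
  - by apply: coprimep_div_gcd; rewrite B0 orbT.
  - by apply: contra_neq B0 => e; rewrite EB e mul0r.
  apply: (mulfI (mulf_neq0 g0 g20)).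
  have -> : g * (g \Po 'X^2) * (B %/ g * (x *: (A %/ g \Po 'X^2) -
      d%:R *: ('X * (B %/ g \Po 'X^2)))) =
    (B %/ g * g) * (x *: ((A %/ g * g) \Po 'X^2) - d%:R *: ('X * ((B %/ g * g) \Po 'X^2))).
    by rewrite !comp_polyM -!mul_polyC; ring.
  by rewrite -EA -EB h {1}EB {1}EA comp_polyM; ring.
move=> h; have /size_poly1P[c c0 Bc] : size B == 1%N.
  (* Composition with 'X^2 preserves coprimality, so the equation makes [B \Po 'X^2] divide [B]; it
     has twice the degree, hence B is constant. *)
  have dv : B \Po 'X^2 %| B.
    have cop2 : coprimep (B \Po 'X^2) (A \Po 'X^2).
      by rewrite coprimep_sym; exact: coprimep_comp_poly.
    have : B \Po 'X^2 %| (B * x%:P) * (A \Po 'X^2).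
      have -> : B * x%:P * (A \Po 'X^2) =
          (B \Po 'X^2) * A + (B \Po 'X^2) * (d%:R *: ('X * B)).
        by rewrite -h -!mul_polyC; ring.
      by rewrite dvdp_add // dvdp_mulr.
    rewrite Gauss_dvdpl // mulrC mul_polyC dvdpZr //.
    exact: lt0r_neq0.
  have := dvdp_leq B0 dv; have := size_comp_poly B 'X^2; rewrite size_polyXn /=.
  have := size_poly_gt0 B; rewrite B0.
  by move: (size _) (size _) => b c; lia.
have h1 : x *: (A \Po 'X^2) - (d%:R * c) *: 'X = A.
  apply: (mulfI (_ : c%:P != 0)); first by rewrite polyC_eq0.
  by move: h; rewrite Bc comp_polyC => <-; rewrite -!mul_polyC rmorphM /=; ring.
have c1 k : A`_(2 ^ k) = x ^+ k * - (d%:R * c).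
  elim: k => [|k IH].
    rewrite -h1 coefB !coefZ coefX coef_comp_poly_Xn //= mulr0 sub0r.
    by rewrite mulr1 mul1r.
  rewrite -h1 coefB !coefZ coefX coef_comp_poly_Xn // expnS dvdn_mulr // mulKn // IH.
  have /negPf -> : (2 * 2 ^ k != 1)%N by lia.
  by rewrite mulr0 subr0 exprS mulrA.
have := c1 (size A); rewrite nth_default; last by apply: ltnW; exact: ltn_expl.
move/esym/eqP; rewrite mulf_eq0 expf_eq0 (gt_eqF x_gt0) andbF oppr_eq0 mulf_eq0.
by rewrite (negPf c0) orbF pnatr_eq0; lia.
Qed.

(** Induction on the degree d in the second variable w. By the functional equation P2(z, w) = x^d
    P(z^2, (w - z)/x) vanishes at the same points, and Q = B(z) P2 - B(z^2) P, with B the leading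
    coefficient, has smaller degree, so Q = 0. For d > 0 its coefficient of degree d - 1 contradicts
    [no_rational_solution]; for d = 0 the polynomial B has too many roots. *)
Lemma nonvanishing (P : {poly {poly R}}) n0 :
  (forall n, (n0 <= n)%N -> P.[(phi n)%:P].[x ^+ (2 ^ n)] = 0) -> P = 0.
Proof.
have [s] := ubnP (size P); elim: s P n0 => // s IH P n0 sP hP.
have [->//|P0] := eqVneq P 0.
have sP0 : (0 < size P)%N by rewrite size_poly_gt0.
pose d := (size P).-1; have sPE : size P = d.+1 by rewrite prednK.
pose B := P`_d; have B0 : B != 0 by rewrite -[B]/(lead_coef P) lead_coef_eq0.
pose P2 : {poly {poly R}} :=
  \sum_(i < d.+1) (x ^+ (d - i) *: (P`_i \Po 'X^2)) *: ('X - 'X%:P) ^+ i.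
have evP2 n : P2.[(phi n)%:P].[x ^+ (2 ^ n)] =
    x ^+ d * P.[(phi n.+1)%:P].[x ^+ (2 ^ n.+1)].
  rewrite (horner_coef P) sPE /P2 !horner_sum mulr_sumr; apply: eq_bigr => i _.
  rewrite (hornerZ _ (('X - 'X%:P) ^+ i)) (horner_exp ('X - 'X%:P)) hornerXsubC.
  rewrite !hornerM hornerZ horner_comp hornerXn !horner_exp hornerD hornerN hornerX.
  rewrite !hornerC phiE addrC addrA addNr add0r exprMn -exprM -expnSr.
  have -> : x ^+ d = x ^+ (d - i) * x ^+ i by rewrite -exprD subnK // -ltnS.
  by ring.
pose Q : {poly {poly R}} := B *: P2 - (B \Po 'X^2) *: P.
have cP2 j : P2`_j = \sum_(i < d.+1) x ^+ (d - i) *: (P`_i \Po 'X^2) *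
    (('X - 'X%:P) ^+ i)`_j.
  by rewrite coef_sum; apply: eq_bigr => i _; rewrite coefZ.
have Q0 : Q = 0.
  apply: (IH _ n0) => [|n nn]; last first.
    rewrite /Q hornerD hornerN !hornerZ hornerD hornerN !hornerM evP2.
    by rewrite !hP ?leqW // !mulr0 subrr.
  apply: (@leq_ltn_trans d); last by rewrite -ltnS -sPE.
  apply/leq_sizeP => j dj; rewrite coefB !coefZ cP2 big_ord_recr /= subnn expr0 scale1r.
  rewrite big1 => [|i _]; last first.
    by rewrite coef_XsubC_exp ?gtn_eqF ?mulr0 ?(leq_trans _ dj) ?(ltnW (ltn_ord i)).
  rewrite add0r coef_XsubC_exp // -/B; have [->|ne] := eqVneq j d.
    by rewrite -/B mulr1 mulrC subrr.
  by rewrite nth_default ?mulr0 ?subrr // sPE ltn_neqAle eq_sym ne.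
have [d0|dn0] := posnP d.
  have PC : P = B%:P by rewrite /B d0; apply: size1_polyC; rewrite sPE d0.
  have hB n : (n0 <= n)%N -> root B (x ^+ (2 ^ n)).
    by move=> /hP; rewrite PC hornerC => /rootP.
  pose rs := [seq x ^+ (2 ^ n) | n <- iota n0 (size B)].
  have : (size rs < size B)%N; last by rewrite size_map size_iota ltnn.
  apply: max_poly_roots => //.
    by apply/allP => y /mapP[n]; rewrite mem_iota => /andP[/hB h _] ->.
  rewrite map_inj_uniq ?iota_uniq // => i j.
  by move/(ieexprIn x_gt0 (negbT (lt_eqF x_lt1)))/(@expnI 2 isT).
exfalso; apply: (@no_rational_solution P`_d.-1 B d) => //.
have := congr1 (fun q : {poly {poly R}} => q`_d.-1) Q0; rewrite coefB !coefZ coef0.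
move/eqP; rewrite subr_eq0 => /eqP <-; congr (_ * _).
rewrite cP2; have [e eE] : exists e, d = e.+1 by exists d.-1; rewrite prednK.
rewrite /B eE /= big_ord_recr /= subnn expr0 scale1r coefpred_XsubC_exp.
rewrite big_ord_recr /= subSnn expr1 coef_XsubC_exp // eqxx mulr1 big1 => [|i _].
  by rewrite add0r mulrN scaler_nat mulrC mulrnAr.
by rewrite coef_XsubC_exp ?gtn_eqF ?mulr0 ?(ltnW (ltn_ord i)).
Qed.

End FunctionalEquation.

Lemma det_le (F : numDomainType) n (W : 'M[F]_n) B :
  (forall i j, `|W i j| <= B) -> `|\det W| <= n`!%:R * B ^+ n.
Proof.
move=> h; apply: (le_trans (ler_norm_sum _ _ _)).
rewrite -card_Sn mulr_natl -sumr_const.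
apply: ler_sum => s _; rewrite normrM normrX normrN1 expr1n mul1r normr_prod.
rewrite -[n in B ^+ n]card_ord -prodr_const; apply: ler_prod => i _.
by rewrite normr_ge0 h.
Qed.

Lemma adj_le (F : numDomainType) n (W : 'M[F]_n.+1) B i j :
  (forall i j, `|W i j| <= B) -> `|\adj W i j| <= n`!%:R * B ^+ n.
Proof.
move=> h; rewrite mxE /cofactor normrM normrX normrN1 expr1n mul1r.
by apply: det_le => k l; rewrite !mxE.
Qed.

Lemma det_int n (W : 'M[rat]_n) : (forall i j, W i j \is a Num.int) ->
  \det W \is a Num.int.
Proof.
move=> h; apply: rpred_sum => s _; rewrite rpredMsign.
by apply: rpred_prod => i _; exact: h.
Qed.

(** * Liouville's inequality by matrices *)

Section Liouville.
Variable R : realType.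
Notation rR := (ratr : rat -> R).

(** D^(n+1) |det W| is a nonzero integer, hence at least 1. The adjugate turns v W = g v into det W
    v = g v adj W, and comparing sums of absolute values of entries bounds |det W| by |g| (n+1)!
    B^n. *)
Lemma liouville_mx n (W : 'M[rat]_n.+1) (D : nat) (B : rat) (v : 'rV[R]_n.+1) g :
  W \in unitmx -> (forall i j, D%:R * W i j \is a Num.int) ->
  (forall i j, `|W i j| <= B) ->
  v != 0 -> v *m map_mx rR W = g *: v -> (0 < D)%N ->
  1 <= `|g| * (n.+1)`!%:R * D%:R ^+ n.+1 * rR B ^+ n.
Proof.
move=> Wu WD WB v0 vW D0.
have B0 : 0 <= B by apply: le_trans (WB ord0 ord0).
have d1 : 1 <= D%:R ^+ n.+1 * `|\det W|.
  have -> : D%:R ^+ n.+1 * `|\det W| = `|\det (D%:R *: W)|.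
    by rewrite detZ normrM normrX normr_nat.
  apply: norm_intr_ge1; first by apply: det_int => i j; rewrite mxE.
  rewrite detZ; apply: mulf_neq0; first by rewrite expf_neq0 // pnatr_eq0 -lt0n.
  by rewrite -unitfE -unitmxE.
pose s := \sum_j `|v 0 j|.
have s0 : 0 < s.
  rewrite lt_neqAle sumr_ge0 // andbT eq_sym; apply: contra_neq v0 => h.
  apply/rowP => j; rewrite mxE; apply/eqP; rewrite -normr_eq0.
  have := h => /eqP; rewrite psumr_eq0 // => /allP/(_ j).
  by rewrite mem_index_enum => /(_ isT).
have e : rR (\det W) *: v = g *: (v *m map_mx rR (\adj W)).
  rewrite scalemxAl -vW -mulmxA -map_mxM mul_mx_adj map_scalar_mx.
  by rewrite mul_mx_scalar.
have le1 : rR `|\det W| * s <= `|g| * ((n.+1)`!%:R * rR B ^+ n) * s.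
  have -> : rR `|\det W| * s = \sum_j `|(rR (\det W) *: v) 0 j|.
    rewrite mulr_sumr; apply: eq_bigr => j _.
    by rewrite mxE normrM -ratr_norm.
  rewrite e -mulrA; under eq_bigr do rewrite mxE normrM.
  rewrite -mulr_sumr ler_wpM2l //.
  apply: (@le_trans _ _ (\sum_(j < n.+1) (n`!%:R * rR B ^+ n) * s)).
    apply: ler_sum => j _; rewrite mxE mulr_sumr; apply: (le_trans (ler_norm_sum _ _ _)).
    apply: ler_sum => k _; rewrite normrM mulrC ler_wpM2r // mxE -ratr_norm.
    by rewrite -(ratr_nat R) -rmorphXn -rmorphM ler_rat; exact: adj_le.
  rewrite sumr_const card_ord -mulr_natl factS natrM.
  by rewrite le_eqVlt; apply/orP; left; apply/eqP; ring.
rewrite ler_pM2r // in le1.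
have : rR 1 <= rR (D%:R ^+ n.+1 * `|\det W|) by rewrite ler_rat.
rewrite rmorph1 rmorphM rmorphXn /= ratr_nat => d2; apply: (le_trans d2).
apply: (@le_trans _ _ (D%:R ^+ n.+1 * (`|g| * ((n.+1)`!%:R * rR B ^+ n)))).
  by rewrite ler_wpM2l ?exprn_ge0.
by rewrite le_eqVlt; apply/orP; left; apply/eqP; ring.
Qed.

(** [M] is the companion matrix of the minimal polynomial of [beta] and [v] a left eigenvector. If
    G(beta) != 0, then G is coprime to that polynomial, and Bezout with Cayley-Hamilton inverts
    G(M). *)
Lemma algebraic_matrix (beta : R) : algebraicOver rR beta ->
  exists n (M : 'M[rat]_n.+1) (v : 'rV[R]_n.+1), v != 0 /\
   forall G : {poly rat}, (map_poly rR G).[beta] != 0 ->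
     horner_mx M G \in unitmx /\
     v *m map_mx rR (horner_mx M G) = (map_poly rR G).[beta] *: v.
Proof.
move=> [p0 p00 rp0].
have [chi [chim rchi chimin]] : exists chi : {poly rat}, [/\ chi \is monic,
    root (map_poly rR chi) beta &
    forall q : {poly rat}, q != 0 -> root (map_poly rR q) beta -> (size chi <= size q)%N].
  pose Pn k := `[< exists q : {poly rat},
    [/\ q != 0, root (map_poly rR q) beta & size q = k] >].
  have exP : exists k, Pn k by exists (size p0); apply/asboolP; exists p0.
  case: (ex_minnP exP) => k /asboolP[q [q0 rq sq]] kmin.
  have l0 : (lead_coef q)^-1 != 0 by rewrite invr_eq0 lead_coef_eq0.
  exists ((lead_coef q)^-1 *: q); split.
  - by rewrite monicE lead_coefZ mulVf // lead_coef_eq0.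
  - by rewrite map_polyZ rootZ // fmorph_eq0.
  - move=> r r0 rr; rewrite size_scale // sq; apply: kmin.
    by apply/asboolP; exists r.
have chi0 : chi != 0 by exact: monic_neq0.
have [n [M MC]] : exists n (M : 'M[rat]_n.+1), char_poly M = chi.
  have s2 : exists n, (size chi).-1 = n.+1.
    exists (size chi).-2; rewrite prednK // -ltnS prednK ?size_poly_gt0 //.
    rewrite ltnNge; apply/negP => /size1_polyC e; move: rchi chi0.
    by rewrite e map_polyC rootC /= fmorph_eq0 polyC_eq0 => ->.
  have := companionmxK chim; move: (companionmx chi) => M; case: s2 => n.
  by move: M; move: (size chi).-1 => k M e; subst k; exists n, M.
have : eigenvalue (map_mx rR M) beta.
  by rewrite eigenvalue_root_char -map_char_poly MC.
case/eigenvalueP => v vM v0; exists n, M, v; split => // G G0; split.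
  have cop : coprimep chi G.
    have [g0 gchi] : gcdp chi G != 0 /\ gcdp chi G %| chi.
      by rewrite gcdp_eq0 (negPf chi0) dvdp_gcdl.
    rewrite /coprimep; apply/eqP.
    have := divpK gchi; set h := chi %/ gcdp chi G => hE.
    have h0 : h != 0 by apply: contra_neq chi0 => h0; rewrite -hE h0 mul0r.
    have rh : root (map_poly rR h) beta.
      move: rchi; rewrite -hE rmorphM rootM => /orP[//|/eqP rg].
      move: G0; rewrite -(divpK (dvdp_gcdr chi G)) rmorphM hornerM rg mulr0.
      by rewrite eqxx.
    have := chimin _ h0 rh; rewrite -{1}hE size_mul //.
    have := size_poly_gt0 (gcdp chi G); rewrite g0.
    have := size_poly_gt0 h; rewrite h0.
    by move: (size h) (size (gcdp chi G)) => s t; clear; lia.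
  have [[u w] /= e] := Bezout_eq1_coprimepP _ _ cop.
  have := congr1 (horner_mx M) e; rewrite rmorphD !rmorphM rmorph1 /=.
  have -> : horner_mx M chi = 0 by rewrite -MC; exact: Cayley_Hamilton.
  by rewrite mulr0 add0r => /mulmx1_unit[].
have hM : v *m map_mx rR M = beta *: v by [].
elim/poly_ind: G {G0} => [|G c IH].
  by rewrite !rmorph0 horner0 scale0r mulmx0.
rewrite !rmorphD !rmorphM /= !map_polyX map_polyC hornerD hornerM hornerX hornerC.
rewrite horner_mx_X horner_mx_C map_scalar_mx mulmxDr -mulmxE mulmxA IH.
by rewrite -scalemxAl hM mul_mx_scalar scalerA scalerDl.
Qed.

End Liouville.

(** There are (N + 1)^2 unknown coefficients and N^2 linear conditions. *)
Lemma auxiliary_polynomial (F : {poly rat}) N : exists c : 'M[rat]_N.+1, c != 0 /\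
  forall l, (l < N ^ 2)%N ->
    (\sum_i \sum_j c i j *: ('X^j * F ^+ i))`_l = 0.
Proof.
pose T : finType := ('I_N.+1 * 'I_N.+1)%type.
pose A : 'M[rat]_(#|T|, N ^ 2) := \matrix_(k, l)
  ('X^((enum_val k : T).2) * F ^+ ((enum_val k : T).1))`_l.
have : kermx A != 0.
  rewrite kermx_eq0 /row_free neq_ltn; apply/orP; left.
  apply: (leq_ltn_trans (rank_leq_col A)); rewrite card_prod !card_ord.
  by rewrite -mulnn ltn_mul.
case/rowV0Pn => u /sub_kermxP uA u0.
exists (\matrix_(i, j) u 0 (enum_rank (i, j))); split=> [|l lN].
  apply: contra_neq u0 => h; apply/rowP => k; rewrite [RHS]mxE.
  have := congr1 (fun m : 'M[rat]_N.+1 => m (enum_val k : T).1 (enum_val k : T).2) h.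
  by rewrite !mxE -surjective_pairing enum_valK.
have := congr1 (fun m : 'rV[rat]_(N ^ 2) => m 0 (Ordinal lN)) uA; rewrite !mxE => h.
rewrite -[RHS]h coef_sum; under eq_bigr do rewrite coef_sum.
rewrite pair_big /= (reindex_onto (@enum_val T T) enum_rank) /=; last first.
  by move=> t _; rewrite enum_rankK.
apply: eq_big => [k|k _]; first by rewrite enum_valK eqxx.
by rewrite !mxE coefZ -surjective_pairing enum_valK.
Qed.

Section SmallValues.
Variable R : realType.
Notation rR := (ratr : rat -> R).

(** At the truncation [F] the polynomial has order at least N^2 in z. Passing from F(z) to [phi]
    costs the same order, as powers are Lipschitz on [0, Phi]. It matters that [C] serves all z,
    which will run through x^(2^n). *)
Lemma small_values (F : {poly rat}) N (c : 'M[rat]_N.+1) (Phi K : R) : 1 <= Phi -> 0 <= K ->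
  (forall l, (l < N ^ 2)%N -> (\sum_i \sum_j c i j *: ('X^j * F ^+ i))`_l = 0) ->
  exists2 C : R, 0 <= C & forall z phi : R, 0 <= z <= 1 ->
    0 <= (map_poly rR F).[z] <= phi -> phi <= Phi ->
    phi - (map_poly rR F).[z] <= K * z ^+ (N ^ 2) ->
    `|\sum_(i < N.+1) \sum_(j < N.+1) rR (c i j) * z ^+ j * phi ^+ i| <= C * z ^+ (N ^ 2).
Proof.
move=> Phi1 K0 hc; set Q := \sum_i _ in hc.
have Phi0 : 0 <= Phi by apply: le_trans Phi1.
pose C1 : R := \sum_(i < N.+1) \sum_(j < N.+1) `|rR (c i j)| * (N%:R * Phi ^+ N * K).
pose C2 : R := \sum_(l < size (map_poly rR Q)) `|(map_poly rR Q)`_l|.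
exists (C1 + C2) => [|z phi /andP[z0 z1] /andP[f0 fphi] phiPhi hK].
  rewrite addr_ge0 ?sumr_ge0 // => i _; rewrite sumr_ge0 // => j _.
  by rewrite !mulr_ge0 ?exprn_ge0 ?ler0n.
set f := (map_poly rR F).[z] in f0 fphi hK *.
have phi0 : 0 <= phi by apply: le_trans fphi.
have -> : \sum_(i < N.+1) \sum_(j < N.+1) rR (c i j) * z ^+ j * phi ^+ i =
    \sum_(i < N.+1) \sum_(j < N.+1) rR (c i j) * z ^+ j * (phi ^+ i - f ^+ i) +
    (map_poly rR Q).[z].
  rewrite /Q rmorph_sum horner_sum -big_split; apply: eq_bigr => i _ /=.
  rewrite rmorph_sum horner_sum -big_split; apply: eq_bigr => j _ /=.
  rewrite map_polyZ rmorphM !rmorphXn /= map_polyX hornerZ hornerM !horner_exp hornerX.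
  by rewrite -/f; ring.
rewrite mulrDl; apply: (le_trans (ler_normD _ _)); apply: lerD.
  rewrite mulr_suml; apply: (le_trans (ler_norm_sum _ _ _)); apply: ler_sum => i _.
  rewrite mulr_suml; apply: (le_trans (ler_norm_sum _ _ _)); apply: ler_sum => j _.
  rewrite 2!normrM -!mulrA ler_wpM2l // normrX (ger0_norm z0).
  apply: (@le_trans _ _ (1 * `|phi ^+ i - f ^+ i|)).
    by rewrite ler_wpM2r // exprn_ile1.
  rewrite mul1r subrXX normrM ger0_norm ?subr_ge0 //.
  apply: (@le_trans _ _ (K * z ^+ (N ^ 2) * (N%:R * Phi ^+ N))); last first.
    by rewrite le_eqVlt; apply/orP; left; apply/eqP; ring.
  apply: ler_pM => //; first by rewrite subr_ge0.
  apply: (le_trans (ler_norm_sum _ _ _)).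
  apply: (@le_trans _ _ (\sum_(k < i) Phi ^+ N)).
    apply: ler_sum => k _; rewrite normrM !normrX !ger0_norm //.
    apply: (@le_trans _ _ (Phi ^+ (i.-1 - k) * Phi ^+ k)).
      apply: ler_pM; rewrite ?exprn_ge0 //; apply: lerXn2r; rewrite ?nnegrE //.
      exact: le_trans phiPhi.
    rewrite -exprD ler_weXn2l //; have := ltn_ord i; have := ltn_ord k; lia.
  rewrite sumr_const card_ord -[leLHS]mulr_natl ler_wpM2r ?exprn_ge0 // ler_nat.
  by rewrite -ltnS.
rewrite horner_coef mulr_suml; apply: (le_trans (ler_norm_sum _ _ _)).
apply: ler_sum => l _; rewrite normrM.
have [lN|Nl] := ltnP l (N ^ 2); first by rewrite coef_map hc //= rmorph0 normr0 !mul0r.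
by rewrite ler_wpM2l // normrX ger0_norm // ler_wiXn2l.
Qed.

End SmallValues.

(** * The lacunary series and its functional equation *)

Section LacunarySeries.
Variables (R : realType) (x : R).
Hypotheses (x_gt0 : 0 < x) (x_lt1 : x < 1).
Implicit Types z : R.

Definition lacunary_term z k := x ^+ k * z ^+ (2 ^ k).

Definition lacunary z : R := limn (series (lacunary_term z)).

Let x0 : 0 <= x. Proof. exact: ltW. Qed.

Lemma lacunary_term_ge0 z k : 0 <= z -> 0 <= lacunary_term z k.
Proof. by move=> z0; rewrite mulr_ge0 ?exprn_ge0. Qed.

Lemma is_cvg_lacunary z : 0 <= z <= 1 -> cvgn (series (lacunary_term z)).
Proof.
move=> /andP[z0 z1].
apply: (@series_le_cvg _ _ (geometric 1 x)) => [n|n|n|].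
- exact: lacunary_term_ge0.
- by rewrite /= mul1r exprn_ge0.
- by rewrite /= mul1r -[leRHS]mulr1 ler_wpM2l ?exprn_ge0 // exprn_ile1.
- by apply: is_cvg_geometric_series; rewrite ger0_norm.
Qed.

Lemma lacunary_ge z K : 0 <= z <= 1 -> series (lacunary_term z) K <= lacunary z.
Proof.
move=> z01; apply: nondecreasing_cvgn_le; last exact: is_cvg_lacunary.
apply/nondecreasing_seqP => n; rewrite /series /= big_nat_recr //= lerDl.
by apply: lacunary_term_ge0; case/andP: z01.
Qed.

Lemma lacunary_tail z K : 0 <= z <= 1 ->
  lacunary z - series (lacunary_term z) K <= (1 - x)^-1 * z ^+ (2 ^ K).
Proof.
move=> z01; have /andP[z0 z1] := z01; rewrite lerBlDl.
apply: limr_le; first exact: is_cvg_lacunary.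
near=> n; have Kn : (K <= n)%N by near: n; exact: nbhs_infty_ge.
rewrite /series /= (@big_cat_nat _ _ _ K) //= lerD2l.
apply: (@le_trans _ _ (\sum_(K <= k < n) x ^+ k * z ^+ (2 ^ K))).
  apply: ler_sum_nat => k /andP[Kk _]; rewrite ler_wpM2l ?exprn_ge0 // ler_wiXn2l //.
  by rewrite leq_exp2l.
rewrite -mulr_suml ler_wpM2r ?exprn_ge0 //.
apply: (@le_trans _ _ (series (geometric 1 x) n)).
  rewrite /series /= [leRHS](@big_cat_nat _ _ _ K) //=.
  under [X in _ <= _ + X]eq_bigr do rewrite mul1r.
  by rewrite lerDr sumr_ge0 // => k _; rewrite mul1r exprn_ge0.
have -> : (1 - x)^-1 = 1 / (1 - x) by rewrite mul1r.
by apply: geometric_le_lim => //; rewrite ger0_norm.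
Unshelve. all: by end_near. Qed.

Lemma lacunary_le z : 0 <= z <= 1 -> lacunary z <= (1 - x)^-1.
Proof.
move=> z01; have := lacunary_tail 0 z01; rewrite /series /= big_geq // subr0.
move/le_trans; apply; rewrite -[leRHS]mulr1 ler_wpM2l ?invr_ge0 ?subr_ge0 ?(ltW x_lt1) //.
by rewrite expn0 expr1; case/andP: z01.
Qed.

Lemma lacunaryE z : 0 <= z <= 1 -> lacunary z = z + x * lacunary (z ^+ 2).
Proof.
move=> z01; have /andP[z0 z1] := z01.
have z201 : 0 <= z ^+ 2 <= 1 by rewrite exprn_ge0 // exprn_ile1.
have c1 := is_cvg_lacunary z01; have c2 := is_cvg_lacunary z201.
have h : (z + x * series (lacunary_term (z ^+ 2)) n) @[n --> \oo] -->
    z + x * lacunary (z ^+ 2).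
  by apply: cvgD; [exact: cvg_cst|apply: cvgM; [exact: cvg_cst|exact: c2]].
apply: (@cvg_unique _ (@norm_hausdorff _ R) (series (lacunary_term z) n.+1 @[n --> \oo])).
  have : series (lacunary_term z) n @[n --> \oo] --> lacunary z by exact: c1.
  by rewrite -(cvg_shiftS (series (lacunary_term z))).
apply: cvg_trans h; apply: near_eq_cvg; near=> n.
rewrite /series /= big_nat_recl //= /lacunary_term expr0 expn0 expr1 mul1r mulr_sumr.
congr (_ + _); apply: eq_bigr => k _.
by rewrite (exprS x) expnS exprM mulrA.
Unshelve. all: by end_near. Qed.

Lemma lacunary_iter n : lacunary x =
  \sum_(0 <= k < n) x ^+ k * x ^+ (2 ^ k) + x ^+ n * lacunary (x ^+ (2 ^ n)).
Proof.
elim: n => [|n IH]; first by rewrite big_geq // add0r expr0 mul1r expn0 expr1.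
rewrite big_nat_recr //= IH -addrA; congr (_ + _).
rewrite lacunaryE ?exprn_ge0 ?exprn_ile1 // ?ltW // mulrDr; congr (_ + _).
by rewrite mulrA -exprSr -exprM -expnSr.
Qed.

End LacunarySeries.

Lemma pow_int (a b j K : nat) : (0 < b)%N -> (j <= K)%N ->
  b%:R ^+ K * (a%:R / b%:R) ^+ j \is a (@Num.int rat).
Proof.
move=> b0 jK; have b0' : b%:R != 0 :> rat by rewrite pnatr_eq0 -lt0n.
rewrite expr_div_n -(subnK jK) exprD -mulrA [X in _ * X]mulrC divfK ?expf_neq0 //.
by rewrite -!natrX rpredM // rpred_nat.
Qed.

Lemma common_denominator (I : finType) (f : I -> rat) :
  exists2 m : nat, (0 < m)%N & forall i, m%:R * f i \is a Num.int.
Proof.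
exists (\prod_i `|denq (f i)|%N) => [|i].
  by rewrite prodn_gt0 // => i; rewrite absz_gt0 denq_eq0.
rewrite (bigD1 i) //= natrM mulrAC rpredM //; last exact: rpred_nat.
have -> : `|denq (f i)|%N%:R * f i = (numq (f i))%:~R; last exact: rpred_int.
rewrite -{2}(divq_num_den (f i)) natr_absz ger0_norm ?denq_ge0 //.
by rewrite mulrC divfK ?intr_eq0 ?denq_eq0.
Qed.

Section MatrixPowers.
Variable n : nat.
Implicit Types Y : 'M[rat]_n.+1.

Lemma mx_pow_le Y (mu : rat) k i j : 1 <= n.+1%:R * mu ->
  (forall i j, `|Y i j| <= mu) -> `|(Y ^+ k) i j| <= (n.+1%:R * mu) ^+ k.
Proof.
move=> mu1 h; elim: k i j => [|k IH] i j.
  by rewrite expr0 expr0 mxE; case: eqP => _; rewrite ?normr1 ?normr0.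
rewrite exprS mxE; apply: (le_trans (ler_norm_sum _ _ _)).
rewrite exprS -mulrA mulr_natl -[X in _ *+ X](card_ord n.+1) -sumr_const.
by apply: ler_sum => l _; rewrite normrM ler_pM.
Qed.

Lemma mx_pow_int Y (s : rat) k K : s \is a Num.int ->
  (forall i j, s * Y i j \is a Num.int) -> (k <= K)%N ->
  forall i j, s ^+ K * (Y ^+ k) i j \is a Num.int.
Proof.
move=> sI h kK i j; rewrite -(subnK kK) exprD -mulrA rpredM ?rpredX //.
elim: k {kK} i j => [|k IH] i j.
  by rewrite !expr0 mul1r mxE rpred_nat.
rewrite !exprS mxE mulr_sumr rpred_sum // => l _.
by rewrite mulrACA rpredM.
Qed.

End MatrixPowers.

(** * Denominators and sizes along the orbit x^(2^n) *)

Section Mahler.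
Variables (R : realType) (a b : nat).
Hypotheses (a_gt0 : (0 < a)%N) (ab : (a < b)%N).
Notation rR := (ratr : rat -> R).

Let xq : rat := a%:R / b%:R.
Let x : R := a%:R / b%:R.

Let b_gt0 : (0 < b)%N. Proof. exact: leq_trans ab. Qed.
Let xqE : rR xq = x. Proof. by rewrite /xq /x rmorphM fmorphV /= !ratr_nat. Qed.
Let xq_gt0 : 0 < xq. Proof. by rewrite divr_gt0 ?ltr0n. Qed.
Let xq_lt1 : xq < 1. Proof. by rewrite ltr_pdivrMr ?ltr0n // mul1r ltr_nat. Qed.
Let x_gt0 : 0 < x. Proof. by rewrite divr_gt0 ?ltr0n. Qed.
Let x_lt1 : x < 1. Proof. by rewrite ltr_pdivrMr ?ltr0n // mul1r ltr_nat. Qed.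

Let head n : rat := \sum_(0 <= k < n) xq ^+ k * xq ^+ (2 ^ k).

Lemma head_int n : (b ^ (n + 2 ^ n))%:R * head n \is a Num.int.
Proof.
rewrite natrX mulr_sumr big_nat rpred_sum // => k /andP[_ kn].
rewrite -exprD; apply: pow_int => //.
by apply: leq_add; [exact: ltnW|rewrite leq_exp2l // ltnW].
Qed.

Lemma head_le n : 0 <= head n <= (1 - xq)^-1.
Proof.
have x0 := ltW xq_gt0; apply/andP; split.
  by apply: sumr_ge0 => k _; rewrite mulr_ge0 ?exprn_ge0.
apply: (@le_trans _ _ (\sum_(0 <= k < n) xq ^+ k)).
  apply: ler_sum => k _; rewrite -[leRHS]mulr1 ler_wpM2l ?exprn_ge0 //.
  by rewrite exprn_ile1 // ltW.
rewrite -[leRHS]mul1r ler_pdivlMr ?subr_gt0 // big_mkord.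
have -> : (\sum_(k < n) xq ^+ k) * (1 - xq) = 1 - xq ^+ n.
  by rewrite -[RHS]opprB subrX1; ring.
by rewrite gerBl exprn_ge0.
Qed.

Variables (N d : nat) (c : 'M[rat]_N.+1) (M : 'M[rat]_d.+1).

(* The value of the auxiliary polynomial at (z, F(z)) for z = x^(2^n), where  *)
(* F(z) = x^-n (F(x) - head n) and 'X stands for F(x).                        *)
Definition shifted_poly n : {poly rat} := \sum_i \sum_j
  (c i j * (xq ^+ (2 ^ n)) ^+ j * (xq ^+ n)^-1 ^+ i) *: ('X - (head n)%:P) ^+ i.

Lemma shifted_poly_eval n : (map_poly rR (shifted_poly n)).[lacunary x x] =
  \sum_(i < N.+1) \sum_(j < N.+1) rR (c i j) * (x ^+ (2 ^ n)) ^+ j *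
    lacunary x (x ^+ (2 ^ n)) ^+ i.
Proof.
rewrite /shifted_poly rmorph_sum horner_sum; apply: eq_bigr => i _ /=.
rewrite rmorph_sum horner_sum; apply: eq_bigr => j _ /=.
rewrite map_polyZ rmorphXn rmorphB /= map_polyX map_polyC hornerZ horner_exp.
rewrite hornerXsubC /= (lacunary_iter x_gt0 x_lt1 n).
have -> : rR (head n) = \sum_(0 <= k < n) x ^+ k * x ^+ (2 ^ k).
  by rewrite rmorph_sum; apply: eq_bigr => k _; rewrite rmorphM !rmorphXn /= xqE.
have gen t : rR (c i j * (t ^+ (2 ^ n)) ^+ j * (t ^+ n)^-1 ^+ i) =
    rR (c i j) * (rR t ^+ (2 ^ n)) ^+ j * (rR t ^+ n)^-1 ^+ i.
  by rewrite !rmorphM !rmorphXn fmorphV !rmorphXn.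
have cancel_xn (t L : R) : t != 0 -> t^-1 ^+ i * (t * L) ^+ i = L ^+ i.
  by move=> t0; rewrite -exprMn mulKf.
rewrite gen xqE [X in X - _]addrC addrK -[LHS]mulrA cancel_xn //.
by rewrite expf_neq0 // gt_eqF.
Qed.

Lemma horner_mx_shifted_poly n i j : horner_mx M (shifted_poly n) i j =
  \sum_(k < N.+1) \sum_(l < N.+1) (c k l * (xq ^+ (2 ^ n)) ^+ l * (xq ^+ n)^-1 ^+ k) *
    ((M - (head n)%:M) ^+ k) i j.
Proof.
rewrite /shifted_poly rmorph_sum summxE; apply: eq_bigr => k _.
rewrite rmorph_sum summxE; apply: eq_bigr => l _.
by rewrite /= linearZ /= rmorphXn rmorphB /= horner_mx_X horner_mx_C mxE.
Qed.

(** The four factors clear, in turn, the coefficients [c], the powers of xq^(2^n), the powers of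
    xq^-n, and the powers of M - head n, where [head n] has the denominator b^(n + 2^n). *)
Lemma shifted_poly_int (m D : nat) n :
  (forall i j, m%:R * M i j \is a Num.int) ->
  (forall i j, D%:R * c i j \is a Num.int) ->
  forall i j, (D * b ^ (2 ^ n * N) * a ^ (n * N) * (m * b ^ (n + 2 ^ n)) ^ N)%:R *
    horner_mx M (shifted_poly n) i j \is a Num.int.
Proof.
move=> mM Dc i j; rewrite horner_mx_shifted_poly mulr_sumr rpred_sum // => k _.
rewrite mulr_sumr rpred_sum // => l _.
have lN : (l <= N)%N by rewrite -ltnS.
have kN : (k <= N)%N by rewrite -ltnS.
set s : rat := (m * b ^ (n + 2 ^ n))%:R.
have -> : (D * b ^ (2 ^ n * N) * a ^ (n * N) * (m * b ^ (n + 2 ^ n)) ^ N)%:R *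
   (c k l * (xq ^+ (2 ^ n)) ^+ l * (xq ^+ n)^-1 ^+ k * ((M - (head n)%:M) ^+ k) i j) =
   (D%:R * c k l) * (b%:R ^+ (2 ^ n * N) * xq ^+ (2 ^ n * l)) *
   (a%:R ^+ (n * N) * (b%:R / a%:R) ^+ (n * k)) *
   (s ^+ N * ((M - (head n)%:M) ^+ k) i j).
  have -> : (xq ^+ n)^-1 ^+ k = (b%:R / a%:R) ^+ (n * k).
    by rewrite -exprVn -exprM /xq invf_div.
  rewrite 3!natrM !natrX -/s -exprM.
  by move: (_ ^+ _) (_ ^+ _) (_ ^+ _) (_ ^+ _) => *; ring.
apply: rpredM; first apply: rpredM; first apply: rpredM => //.
- by apply: pow_int => //; rewrite leq_mul2l lN orbT.
- by apply: pow_int => //; rewrite leq_mul2l kN orbT.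
apply: mx_pow_int => //; first exact: rpred_nat.
move=> i' j'; rewrite !mxE mulrBr rpredB //.
  by rewrite /s natrM mulrAC rpredM // rpred_nat.
rewrite -mulr_natl mulrCA rpredM ?rpred_nat // /s natrM -mulrA rpredM ?rpred_nat //.
exact: head_int.
Qed.

(** Only the powers of xq^-n grow with n: those of xq^(2^n) are at most 1, and [head n] stays below
    (1 - xq)^-1. *)
Lemma shifted_poly_le (mu : rat) n : (forall i j, `|M i j| <= mu) ->
  forall i j, `|horner_mx M (shifted_poly n) i j| <=
    (\sum_(k < N.+1) \sum_(l < N.+1) `|c k l|) * xq^-1 ^+ (n * N) *
    (d.+1%:R * (mu + (1 - xq)^-1)) ^+ N.
Proof.
move=> hM i j; set nu := d.+1%:R * _.
have mu0 : 0 <= mu by apply: le_trans (hM ord0 ord0).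
have inv1 : 1 <= (1 - xq)^-1.
  by rewrite -[leLHS]invr1 lef_pV2 ?posrE ?subr_gt0 // gerBl ltW.
have nu1 : 1 <= nu.
  by rewrite -[1]mulr1 ler_pM // ?ler1n // -[1]add0r lerD.
have /andP[h0 h1] := head_le n.
have hY i' j' : `|(M - (head n)%:M) i' j'| <= mu + (1 - xq)^-1.
  rewrite !mxE; apply: (le_trans (ler_normB _ _)); apply: lerD => //.
  by case: eqP => _; rewrite ?mulr1n ?mulr0n ?normr0 ?ger0_norm // (le_trans h0).
have invx1 : 1 <= xq^-1.
  by rewrite -[leLHS]invr1 lef_pV2 ?posrE // ltW.
rewrite horner_mx_shifted_poly -mulrA mulr_suml.
apply: (le_trans (ler_norm_sum _ _ _)); apply: ler_sum => k _.
rewrite mulr_suml; apply: (le_trans (ler_norm_sum _ _ _)); apply: ler_sum => l _.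
have kN : (k <= N)%N by rewrite -ltnS.
rewrite !normrM -!mulrA ler_wpM2l //.
have x0 := ltW xq_gt0.
rewrite (ger0_norm (exprn_ge0 _ (exprn_ge0 _ x0))).
apply: (@le_trans _ _ (1 * (`|(xq ^+ n)^-1 ^+ k| * `|((M - (head n)%:M) ^+ k) i j|))).
  by rewrite ler_wpM2r ?mulr_ge0 // exprn_ile1 ?exprn_ge0 // exprn_ile1 // ltW.
rewrite mul1r; apply: ler_pM => //.
  rewrite ger0_norm ?exprn_ge0 ?invr_ge0 ?exprn_ge0 // -exprVn -exprM.
  by rewrite ler_weXn2l // leq_mul2l kN orbT.
apply: (le_trans (mx_pow_le k i j nu1 hY)).
by rewrite ler_weXn2l.
Qed.

End Mahler.

Section Transcendence.
Variable R : realType.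
Notation rR := (ratr : rat -> R).

(** With E n the value of the auxiliary polynomial at z = x^(2^n), Liouville bounds a nonzero |E n|
    below by a constant times a power of b^(-2^n N) with exponent depending only on the degree,
    while |E n| <= C x^(2^n N^2). *)
Lemma lacunary_transcendental (a b : nat) : (0 < a < b)%N ->
  let x : R := a%:R / b%:R in ~ algebraicOver rR (lacunary x x).
Proof.
move=> /andP[a0 ab] x alg.
have b0 : (0 < b)%N by exact: leq_trans ab.
have b1 : (1 : R) <= b%:R by rewrite ler1n.
have xdef : x = a%:R / b%:R by [].
clearbody x.
have x_gt0 : 0 < x by rewrite xdef divr_gt0 ?ltr0n.
have x_lt1 : x < 1 by rewrite xdef ltr_pdivrMr ?ltr0n // mul1r ltr_nat.
have x_ge0 := ltW x_gt0.
pose xq : rat := a%:R / b%:R.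
have xqE : rR xq = x by rewrite xdef rmorphM fmorphV /= !ratr_nat.
have xqX k : rR (xq ^+ k) = x ^+ k by rewrite rmorphXn /= xqE.
have [d [M [v [v0 hM]]]] := algebraic_matrix alg.
have [m m0 mM] := common_denominator (fun ij : 'I_d.+1 * 'I_d.+1 => M ij.1 ij.2).
(* 5 (d + 1) bounds 4 (d + 1) + d, the exponent of b^(2^n N) in Liouville's inequality: the
   denominator [Dn] contributes b^4 to the power d + 1 and the size [Bn] contributes b to the power
   d. *)
have [N N0 hN] : exists2 N, (0 < N)%N & (b ^ (5 * d.+1))%:R * x ^+ N <= 2^-1.
  have c0 : geometric (b ^ (5 * d.+1))%:R x @ \oo --> (0 : R).
    by apply: cvg_geometric; rewrite ger0_norm.
  have h2 : (0 : R) < 2^-1 by rewrite invr_gt0.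
  have [n _ hn] := (cvgrPdist_lt _ _).1 c0 _ h2.
  exists n.+1 => //; have := hn n.+1 (leqnSn n).
  rewrite /= sub0r normrN ger0_norm ?mulr_ge0 ?exprn_ge0 //; exact: ltW.
(* All that is asked of [K] is N^2 <= 2^K: the tail of the series after K terms is then
   O(z^(N^2)). *)
pose K := (N ^ 2)%N; have NK : (N ^ 2 <= 2 ^ K)%N by apply: ltnW; exact: ltn_expl.
pose F : {poly rat} := \sum_(0 <= k < K) xq ^+ k *: 'X^(2 ^ k).
have FE z : (map_poly rR F).[z] = series (lacunary_term x z) K.
  rewrite /F rmorph_sum horner_sum; apply: eq_bigr => k _ /=.
  by rewrite map_polyZ map_polyXn hornerZ hornerXn /= xqX.
have [c [c0 hc]] := auxiliary_polynomial F N.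
have [D D0 Dc] := common_denominator (fun ij : 'I_N.+1 * 'I_N.+1 => c ij.1 ij.2).
have inv_ge1 : 1 <= (1 - x)^-1.
  by rewrite -[leLHS]invr1 lef_pV2 ?posrE ?subr_gt0 // gerBl.
have inv_ge0 : 0 <= (1 - x)^-1 by apply: le_trans inv_ge1.
have [C C0 hC] := small_values inv_ge1 inv_ge0 hc.
pose phi n := lacunary x (x ^+ (2 ^ n)).
pose E n := \sum_(i < N.+1) \sum_(j < N.+1) rR (c i j) * (x ^+ (2 ^ n)) ^+ j * phi n ^+ i.
have z01 n : 0 <= x ^+ n <= 1 by rewrite exprn_ge0 // exprn_ile1 // ltW.
have E_le n : `|E n| <= C * x ^+ (2 ^ n * N ^ 2).
  rewrite exprM; apply: hC => //.
  - rewrite FE lacunary_ge // andbT; apply: sumr_ge0 => k _.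
    by apply: lacunary_term_ge0 => //; case/andP: (z01 (2 ^ n)%N).
  - exact: lacunary_le.
  - rewrite FE; apply: (le_trans (lacunary_tail x_gt0 x_lt1 K (z01 _))).
    have /andP[? ?] := z01 (2 ^ n)%N.
    by rewrite ler_wpM2l // ler_wiXn2l.
pose mu : rat := \sum_i \sum_j `|M i j|.
have M_le i j : `|M i j| <= mu.
  rewrite /mu (bigD1 i) //= (bigD1 j) //= -addrA lerDl addr_ge0 ?sumr_ge0 // => k _.
  by rewrite sumr_ge0.
pose nu : rat := d.+1%:R * (mu + (1 - xq)^-1).
pose S : rat := \sum_(k < N.+1) \sum_(l < N.+1) `|c k l|.
pose C3 : R := rR (S * nu ^+ N).
pose Dn n := (D * b ^ (2 ^ n * N) * a ^ (n * N) * (m * b ^ (n + 2 ^ n)) ^ N)%N.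
pose Bn n : rat := S * xq^-1 ^+ (n * N) * nu ^+ N.
have liou n : E n != 0 ->
    1 <= `|E n| * (d.+1)`!%:R * (Dn n)%:R ^+ d.+1 * rR (Bn n) ^+ d.
  move=> En0; have := shifted_poly_eval R a0 ab c n; rewrite -xdef => ev.
  have [Wu Wv] := hM (shifted_poly a b c n) ltac:(rewrite ev; exact: En0).
  have W_int := shifted_poly_int a0 ab n (fun i j => mM (i, j)) (fun i j => Dc (i, j)).
  have W_le := shifted_poly_le a0 ab c n M_le.
  rewrite ev in Wv.
  apply: (liouville_mx Wu (W_int) W_le v0 Wv).
  by rewrite !muln_gt0 D0 !expn_gt0 b0 a0 muln_gt0 m0 expn_gt0 b0.
have nn n : (n <= 2 ^ n)%N by apply: ltnW; exact: ltn_expl.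
(* With a <= b and n <= 2^n, the exponents 2^n N, n N and (n + 2^n) N of b add up to at most 4 (2^n
   N). *)
have Dn_le n : (Dn n <= D * m ^ N * b ^ (4 * (2 ^ n * N)))%N.
  apply: (@leq_trans (D * b ^ (2 ^ n * N) * b ^ (n * N) * (m ^ N * b ^ ((n + 2 ^ n) * N)))).
    have ab_exp e : (a ^ e <= b ^ e)%N.
      by elim: e => // e IH; rewrite !expnS leq_mul // ltnW.
    rewrite /Dn expnMn -expnM; apply: leq_mul (leqnn _).
    exact: leq_mul (leqnn _) (ab_exp _).
  have -> : (D * b ^ (2 ^ n * N) * b ^ (n * N) * (m ^ N * b ^ ((n + 2 ^ n) * N)) =
      D * m ^ N * b ^ (2 ^ n * N + n * N + (n + 2 ^ n) * N))%N by rewrite !expnD; ring.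
  apply: leq_mul (leqnn _) _; apply: leq_pexp2l => //.
  have := leq_mul (nn n) (leqnn N); rewrite mulnDl.
  by move: (n * N)%N (2 ^ n * N)%N => s t; clear; lia.
have C3_ge0 : 0 <= C3.
  have xq0 : 0 <= (1 - xq)^-1.
    by rewrite invr_ge0 subr_ge0 ler_pdivrMr ?ltr0n // mul1r ler_nat ltnW.
  rewrite ler0q mulr_ge0 ?sumr_ge0 // => [k _|]; first by rewrite sumr_ge0.
  rewrite exprn_ge0 // mulr_ge0 ?ler0n // addr_ge0 // sumr_ge0 // => k _.
  by rewrite sumr_ge0.
have Bn_le n : rR (Bn n) <= C3 * b%:R ^+ (2 ^ n * N).
  have -> : rR (Bn n) = C3 * x^-1 ^+ (n * N).
    by rewrite /Bn mulrAC rmorphM rmorphXn fmorphV /= xqE.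
  rewrite ler_wpM2l //; apply: (@le_trans _ _ (b%:R ^+ (n * N))).
    apply: lerXn2r; rewrite ?nnegrE ?invr_ge0 ?ler0n // xdef invf_div.
    by rewrite ler_pdivrMr ?ltr0n // ler_peMr ?ler0n // ler1n.
  by rewrite ler_weXn2l // leq_mul2r nn orbT.
pose C4 : R := C * (d.+1)`!%:R * (D * m ^ N)%:R ^+ d.+1 * C3 ^+ d.
have decay n : E n != 0 -> 1 <= C4 * 2^-1 ^+ n.
  move=> /liou h; apply: (le_trans h).
  have Bn_ge0 : 0 <= rR (Bn n).
    rewrite ler0q; apply: le_trans (shifted_poly_le a0 ab c n M_le ord0 ord0).
    exact: normr_ge0.
  pose e := (2 ^ n * N)%N.
  apply: (@le_trans _ _ (C * x ^+ (N * e) * (d.+1)`!%:R *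
      ((D * m ^ N)%:R * b%:R ^+ (4 * e)) ^+ d.+1 * (C3 * b%:R ^+ e) ^+ d)).
    have := E_le n; rewrite (_ : 2 ^ n * N ^ 2 = N * e)%N => [El|]; last first.
      by rewrite /e mulnCA mulnn.
    have h1 : rR (Bn n) ^+ d <= (C3 * b%:R ^+ e) ^+ d.
      apply: lerXn2r; rewrite ?nnegrE //.
      by rewrite (mulr_ge0 C3_ge0) // exprn_ge0 // ler0n.
    have h2 : (Dn n)%:R ^+ d.+1 <= ((D * m ^ N)%:R * b%:R ^+ (4 * e)) ^+ d.+1 :> R.
      apply: lerXn2r; rewrite ?nnegrE ?mulr_ge0 ?exprn_ge0 ?ler0n //.
      by rewrite -natrX -natrM ler_nat; exact: Dn_le.
    have h3 : `|E n| * (d.+1)`!%:R <= C * x ^+ (N * e) * (d.+1)`!%:R.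
      by rewrite ler_wpM2r ?ler0n.
    have D_ge0 : (0 : R) <= (Dn n)%:R ^+ d.+1 by rewrite exprn_ge0 ?ler0n.
    apply: ler_pM h1; [|exact: exprn_ge0|].
      by rewrite mulr_ge0 // mulr_ge0 ?ler0n.
    by apply: ler_pM h2; rewrite // mulr_ge0 ?ler0n.
  have -> : C * x ^+ (N * e) * (d.+1)`!%:R * ((D * m ^ N)%:R * b%:R ^+ (4 * e)) ^+ d.+1 *
      (C3 * b%:R ^+ e) ^+ d = C4 * (x ^+ (N * e) * b%:R ^+ (e * (4 * d.+1 + d))).
    have <- : (b%:R ^+ (4 * e)) ^+ d.+1 * (b%:R ^+ e) ^+ d = b%:R ^+ (e * (4 * d.+1 + d)) :> R.
      by rewrite -!exprM -exprD; congr (_ ^+ _); rewrite mulnDr mulnCA mulnA.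
    rewrite [(_%:R * _) ^+ _]exprMn [(C3 * _) ^+ _]exprMn /C4.
    move: (_ ^+ d.+1) (_ ^+ d.+1) (_ ^+ d) (_ ^+ d) (x ^+ _) (_`!%:R) => *; ring.
  have C4_ge0 : 0 <= C4 by rewrite !mulr_ge0 ?exprn_ge0 ?ler0n.
  rewrite ler_wpM2l //.
  apply: (@le_trans _ _ (((b ^ (5 * d.+1))%:R * x ^+ N) ^+ e)).
    rewrite exprMn -exprM mulrC; apply: ler_wpM2r; first exact: exprn_ge0.
    rewrite natrX -exprM.
    apply: ler_weXn2l b1 _ _ _; rewrite mulnC; apply: leq_mul (leqnn _).
    by clear; lia.
  apply: (@le_trans _ _ (2^-1 ^+ e)).
    by apply: lerXn2r; rewrite ?nnegrE ?mulr_ge0 ?exprn_ge0 ?ler0n ?invr_ge0.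
  apply: ler_wiXn2l; rewrite ?invr_ge0 ?invf_le1 ?ler1n //.
  by rewrite /e; apply: (leq_trans (nn n)); rewrite leq_pmulr.
have [n0 _ hn0] : \forall n \near \oo, `|0 - geometric C4 (2^-1) n| < (1 : R).
  apply: (cvgrPdist_lt _ _).1 => //; apply: cvg_geometric.
  by rewrite ger0_norm ?invr_ge0 // invf_lt1 // ltr1n.
have E0 n : (n0 <= n)%N -> E n = 0.
  move=> /hn0; rewrite /= sub0r normrN => hlt; apply/eqP/negPn/negP => /decay.
  by rewrite leNgt (le_lt_trans (ler_norm _) hlt).
pose P : {poly {poly R}} :=
  \poly_(i < N.+1) \poly_(j < N.+1) rR (c (inord i) (inord j)).
have P0 : P = 0.
  apply: (@nonvanishing R x phi x_gt0 x_lt1 _ P n0) => n.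
    rewrite /phi lacunaryE //; congr (_ + _ * lacunary x _).
    by rewrite -exprM -expnSr.
  move=> /E0 <-; rewrite /P horner_poly horner_sum; apply: eq_bigr => i _.
  rewrite hornerM horner_exp hornerC horner_poly mulr_suml; apply: eq_bigr => j _.
  by rewrite !inord_val.
move/eqP: c0; apply; apply/matrixP => i j; rewrite [RHS]mxE.
have := congr1 (fun q : {poly {poly R}} => q`_i`_j) P0.
rewrite coef_poly ltn_ord coef_poly ltn_ord !coef0 !inord_val => /eqP.
by rewrite fmorph_eq0 => /eqP.
Qed.

End Transcendence.

Theorem theorem2 (R : realType) (p : nat) (hp : (1 < p)%N) :
  let q : R := p%:R in
  let d : R :=
    1344 * ((4 * q ^+ 3 + 3 * q ^+ 2 + 2 * q - 1) / (8 * q ^+ 3)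
            + 1 / (8 * q ^+ 3)
              * \big[+%R/0]_(1 <= k <oo) ((q - 1) / q) ^+ (k + 2 ^ k)%N) in
  (exists (m n : nat) (T : 'M[{malg int[wreathZ 'Z_p]}]_(m, n)),
     vN_dim_ker R T = d%:C)
  /\ ~ algebraicOver (ratr : rat -> R) d.
Proof.
move=> q d.
have p0 : (0 < p)%N by exact: ltnW.
have q0 : q != 0 by rewrite pnatr_eq0 -lt0n.
pose x : R := p.-1%:R / p%:R.
have xE : x = (q - 1) / q by rewrite /x -subn1 natrB.
have x_gt0 : 0 < x by rewrite divr_gt0 ?ltr0n // -subn1 subn_gt0.
have x_lt1 : x < 1 by rewrite ltr_pdivrMr ?ltr0n // mul1r ltr_nat prednK.
have x01 : 0 <= x <= 1 by rewrite !ltW.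
pose S := lacunary x x.
have hS : (\sum_(0 <= k < n) x ^+ (k + 2 ^ k)) @[n --> \oo] --> S.
  have h : series (lacunary_term x x) n @[n --> \oo] --> S.
    exact: is_cvg_lacunary.
  apply: cvg_trans h; apply: near_eq_cvg; near=> n.
  by apply: eq_bigr => k _; rewrite /lacunary_term exprD.
(* [S] includes the term k = 0, which is x. *)
have sumE : \big[+%R/0]_(1 <= k <oo) ((q - 1) / q) ^+ (k + 2 ^ k)%N = S - x.
  have h : (\sum_(0 <= k < n) x ^+ (k + 2 ^ k) - x) @[n --> \oo] --> S - x.
    by apply: cvgB => //; exact: cvg_cst.
  apply: (@cvg_lim _ (@norm_hausdorff _ R)); apply: cvg_trans h.
  apply: near_eq_cvg; near=> n; have n0 : (0 < n)%N by near: n; exact: nbhs_infty_gt.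
  by rewrite [in LHS]big_ltn //= add0n expn0 expr1 addrC addKr -xE.
(* 168 = 1344 / 8. Removing the term k = 0 adds -q^-3 + q^-4, and the resulting 2 q^-2 - 2 q^-3 is 2
   q^-2 (1 - q^-1). No negative multiple is left: the summands are multiples of the dimensions for
   the words (empty), 0, 001, 0000 and for the doubling system. *)
have dE : d = 168%:R * (4%:R * 1 + (3%:R * q^-1 + (2%:R * (q^-1 * (q^-1 * (1 - q^-1))) +
    (q^-1 ^+ 4 + q^-1 ^+ 3 * S)))).
  by rewrite /d sumE xE; field.
clearbody d; split; last first.
  move=> dalg; apply: (@lacunary_transcendental R p.-1 p).
    by lia.
  have nalg k : algebraicOver (ratr : rat -> R) k%:R.
    by rewrite -(ratr_nat R); exact: algebraic_id.
  rewrite -/x -/S.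
  (* Solved for [S], the identity makes F(x) algebraic as soon as [d] is. *)
  have -> : S = (d / 168%:R - (4%:R + (3%:R / q + (2%:R / q / q * (1%:R - 1%:R / q) +
      1%:R / q / q / q / q)))) * q * q * q by rewrite dE; field.
  do ![exact: dalg | exact: algebraic1 | exact: nalg | apply: algebraic_mul
     | apply: algebraic_sub | apply: algebraic_add | apply: algebraic_inv].
have cardA : #|'Z_p| = p by rewrite card_ord Zp_cast.
have hw := @is_kerdim_word R 'Z_p; rewrite cardA in hw.
have [m [n [T hT]]] : is_kerdim (wreathZ 'Z_p) d.
  rewrite dE; apply: is_kerdimMn; apply: is_kerdimD.
    by apply: is_kerdimMn; have := hw [::]; rewrite big_nil.
  apply: is_kerdimD.
    by apply: is_kerdimMn; have := hw [:: false]; rewrite big_seq1.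
  apply: is_kerdimD.
    apply: is_kerdimMn; have := hw [:: false; false; true].
    by rewrite !big_cons big_nil mulr1.
  apply: is_kerdimD.
    by have := hw (nseq 4 false); rewrite /= !big_cons big_nil mulr1 !exprS expr0 mulr1.
  apply: (@is_kerdim_doubling R 'Z_p); rewrite cardA.
  have -> : 1 - p%:R^-1 = x by rewrite xE mulrBl divff // mul1r.
  have h : (q^-1 ^+ 3 * \sum_(0 <= k < n) x ^+ (k + 2 ^ k)) @[n --> \oo] -->
      q^-1 ^+ 3 * S by apply: cvgM => //; exact: cvg_cst.
  by apply: cvg_trans h; apply: near_eq_cvg; near=> n; rewrite mulr_sumr.
by exists m, n, T; exact: vN_dim_kerE hT.
Unshelve. all: by end_near. Qed.
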